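(* Let $R$ be a commutative ring with unity and let $I$ be an ideal of $R$ with $I\neq(0)$ and $I\neq R$. Let $R\Join I=\{(r,r+i)\mid r\in R,\ i\in I\}\subseteq R\times R$, and let $\mathfrak{O}_1=(0)\times I$ and $\mathfrak{O}_2=I\times (0)$, which are common ideals of $R\Join I$ and $R\times R$. Let $X:=\mathrm{Spec}(R)$, $Y:=\mathrm{Spec}(R\Join I)$, $Z:=\mathrm{Spec}(R\times R)\cong \mathrm{Spec}(R)\amalg\mathrm{Spec}(R)$, and let $\alpha:Z\twoheadrightarrow Y$ and $\gamma:Y\twoheadrightarrow X$ be the canonical surjective maps associated to the integral embeddings $R\Join I\hookrightarrow R\times R$ and $R\hookrightarrow R\Join I$, $r\mapsto (r,r)$. Then: (a) For $i=1,2$, the restriction of $\alpha$ $$\alpha|_{Z\setminus V_Z(\mathfrak{O}_i)}:Z\setminus V_Z(\mathfrak{O}_i)\longrightarrow Y\setminus V_Y(\mathfrak{O}_i)$$ is a scheme isomorphism, and $Z\setminus V_Z(\mathfrak{O}_i)\cong X\setminus V_X(I)$. In particular, for each prime ideal $P$ of $R$ such that $P\not\supseteq I$, if we set $\overline{P_1}:=P\times R$ and $\overline{P_2}:=R\times P$, we have $\mathcal{P}_i=\overline{P_i}\cap (R\Join I)$ for $i=1,2$, where $\mathcal{P}_1=\{(p,p+x)\mid p\in P,\ x\in I\}$ and $\mathcal{P}_2=\{(p+x,p)\mid p\in P,\ x\in I\}$, and the following canonical ring homomorphisms are isomorphisms: $$R_P\longrightarrow (R\Join I)_{\mathcal{P}_i}\longrightarrow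 (R\times R)_{\overline{P_i}},\qquad i=1,2.$$ (b) The restriction of $\gamma$ $$\gamma|_{V_Y(\mathfrak{O}_1)\cap V_Y(\mathfrak{O}_2)}:V_Y(\mathfrak{O}_1)\cap V_Y(\mathfrak{O}_2)\longrightarrow V_X(I)$$ is a scheme isomorphism. (c) If $P\in\mathrm{Spec}(R)$ is such that $P\supseteq I$ and $\mathcal{P}\in\mathrm{Spec}(R\Join I)$ is the unique prime ideal such that $\mathcal{P}\cap R=P$, then the following diagram of canonical homomorphisms $$\begin{array}{ccc}(R\Join I)_{\mathcal{P}} & \longrightarrow & R_P\\ \downarrow & & \downarrow u_P\\ R_P\times R_P & \xrightarrow{\ v_P\ } & R_P\times (R_P/I_P)\end{array}$$ is a pullback, where $I_P:=IR_P$, $u_P(x):=(x,x+I_P)$ and $v_P((x,y)):=(x,y+I_P)$ for $x,y\in R_P$; that is, $(R\Join I)_{\mathcal{P}}\cong R_P\Join I_P$.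
   Context: $R\Join I$ is a subring of $R\times R$. The ring $R$ is identified with its image under the diagonal embedding $r\mapsto (r,r)$ in $R\Join I$; $\mathcal{P}\cap R$ denotes the contraction of $\mathcal{P}$ along it. For a ring $A$, $\mathcal{X}=\mathrm{Spec}(A)$ and an ideal $H$ of $A$, $V_{\mathcal{X}}(H)=\{P\in\mathcal{X}\mid P\supseteq H\}$; complements of such sets carry the open subscheme structure, and $V_{\mathcal X}(H)$ carries the closed subscheme structure defined by $H$ (with $V_Y(\mathfrak{O}_1)\cap V_Y(\mathfrak{O}_2)=V_Y(\mathfrak{O}_1+\mathfrak{O}_2)$). In $V_Z(\mathfrak{O}_i)$ the ideal $\mathfrak{O}_i$ is regarded as an ideal of $R\times R$, and in $V_Y(\mathfrak{O}_i)$ as an ideal of $R\Join I$. The ring $R_P\Join I_P$ is $\{(x,x+y)\mid x\in R_P,\ y\in I_P\}\subseteq R_P\times R_P$. In (c), the top horizontal map is induced by $(r,r+i)\mapsto r$ and the left vertical map by the inclusion $R\Join I\subseteq R\times R$. In (a), the maps are induced by $r\mapsto(r,r)$ and by the inclusion $R\Join I\subseteq R\times R$. *)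

(* Defs.v *)
From HB Require Import structures.
From mathcomp Require Import all_boot all_algebra.
From mathcomp Require Import all_classical.
From mathcomp Require Import topology_structure initial_topology subtype_topology.
From mathcomp Require Import ring.

Set Implicit Arguments.
Unset Strict Implicit.
Unset Printing Implicit Defensive.

Import GRing.Theory.
Local Open Scope classical_set_scope.
Local Open Scope ring_scope.
Local Open Scope quotient_scope.

(* Rings are comPzRingType (the zero ring is allowed: it is the ring of
   sections over the empty open set).  [ring_quotient] only knows proper ideals
   of nonzero rings, whereas closed subschemes and sums of ideals need possibly
   improper ones; hence the record below. *)
Record ideal (A : comPzRingType) := Ideal {
  ideal_set :> A -> Prop;
  ideal0 : ideal_set 0;
  idealD : forall a b, ideal_set a -> ideal_set b -> ideal_set (a + b);
  idealM : forall a b, ideal_set b -> ideal_set (a * b) }.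

Lemma ideal_ext (A : comPzRingType) (H K : ideal A) :
  (forall a, H a <-> K a) -> H = K.
Proof.
case: H K => [H h0 hD hM] [K k0 kD kM] /= /predeqP e; rewrite -e in k0 kD kM *.
by congr Ideal; apply: Prop_irrelevance.
Qed.

Lemma idealN (A : comPzRingType) (H : ideal A) a : H a -> H (- a).
Proof. by move=> Ha; rewrite -mulN1r; apply: idealM. Qed.

Lemma idealB (A : comPzRingType) (H : ideal A) a b : H a -> H b -> H (a - b).
Proof. by move=> Ha Hb; apply: idealD => //; apply: idealN. Qed.

Definition ideal_sum_set (A : comPzRingType) (H K : ideal A) : set A :=
  [set c | exists a b, [/\ H a, K b & c = a + b]].

Program Definition ideal_sum (A : comPzRingType) (H K : ideal A) : ideal A :=
  @Ideal A (ideal_sum_set H K) _ _ _.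
Next Obligation. by move=> A H K; exists 0, 0; split; rewrite ?addr0 //; apply: ideal0. Qed.
Next Obligation.
move=> A H K _ _ [a [b [Ha Kb ->]]] [c [d [Hc Kd ->]]]; exists (a + c), (b + d).
by split; [apply: idealD|apply: idealD|rewrite addrACA].
Qed.
Next Obligation.
move=> A H K c _ [a [b [Ha Kb ->]]]; exists (c * a), (c * b).
by split; [apply: idealM|apply: idealM|rewrite mulrDr].
Qed.

Program Definition ideal_gen (A : comPzRingType) (S : set A) : ideal A :=
  @Ideal A [set a | forall H : ideal A, S `<=` ideal_set H -> H a] _ _ _.
Next Obligation. by move=> A S H _; apply: ideal0. Qed.
Next Obligation. by move=> A S a b ha hb H SH; apply: idealD; [apply: ha|apply: hb]. Qed.
Next Obligation. by move=> A S a b hb H SH; apply: idealM; apply: hb. Qed.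

Program Definition ideal_preim (A B : comPzRingType) (f : {rmorphism A -> B})
  (H : ideal B) : ideal A := @Ideal A (fun a => H (f a)) _ _ _.
Next Obligation. by move=> A B f H; rewrite /= rmorph0; apply: ideal0. Qed.
Next Obligation. by move=> A B f H a b; rewrite /= rmorphD; apply: idealD. Qed.
Next Obligation. by move=> A B f H a b; rewrite /= rmorphM; apply: idealM. Qed.

Section QuotientRing.
Variables (A : comPzRingType) (H : ideal A).

Definition quo_equiv (x y : A) : bool := `[< H (x - y) >].

Lemma quo_equiv_refl : reflexive quo_equiv.
Proof. by move=> x; apply/asboolP; rewrite subrr; apply: ideal0. Qed.
Lemma quo_equiv_sym : symmetric quo_equiv.
Proof.
move=> x y; apply/asboolP/asboolP => h; rewrite -opprB; exact: idealN.
Qed.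
Lemma quo_equiv_trans : transitive quo_equiv.
Proof.
move=> y x z /asboolP h /asboolP h'; apply/asboolP.
have -> : x - z = (x - y) + (y - z) by rewrite addrA subrK.
exact: idealD.
Qed.

Canonical quo_equiv_rel :=
  EquivRel quo_equiv quo_equiv_refl quo_equiv_sym quo_equiv_trans.

Definition quo := {eq_quot quo_equiv}.
HB.instance Definition _ := Choice.on quo.
HB.instance Definition _ := EqQuotient.on quo.

Definition quo_class (a : A) : quo := \pi_quo a.

Lemma quo_classP a b : quo_class a = quo_class b <-> H (a - b).
Proof. by split => [/eqmodP/asboolP|h] //; apply/eqmodP/asboolP. Qed.

Lemma quo_ind (P : quo -> Prop) : (forall a, P (quo_class a)) -> forall x, P x.
Proof. by move=> h; elim/quotW. Qed.

Lemma quo_repr a : H (repr (quo_class a) - a).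
Proof. by apply/quo_classP; rewrite /quo_class reprK. Qed.

Definition quo_opp (x : quo) : quo := quo_class (- repr x).
Definition quo_add (x y : quo) : quo := quo_class (repr x + repr y).
Definition quo_mul (x y : quo) : quo := quo_class (repr x * repr y).

Lemma quo_oppE a : quo_opp (quo_class a) = quo_class (- a).
Proof. by apply/quo_classP; rewrite -opprD; apply/idealN/quo_repr. Qed.

Lemma quo_addE a b : quo_add (quo_class a) (quo_class b) = quo_class (a + b).
Proof.
by apply/quo_classP; rewrite opprD addrACA; apply: idealD; apply: quo_repr.
Qed.

Lemma quo_mulE a b : quo_mul (quo_class a) (quo_class b) = quo_class (a * b).
Proof.
apply/quo_classP; set x := repr _; set y := repr _.
have -> : x * y - a * b = x * (y - b) + b * (x - a) by ring.
by apply: idealD; apply: idealM; apply: quo_repr.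
Qed.

Lemma quo_addA : associative quo_add.
Proof. by do 3!elim/quo_ind => ?; rewrite !quo_addE addrA. Qed.
Lemma quo_addC : commutative quo_add.
Proof. by do 2!elim/quo_ind => ?; rewrite !quo_addE addrC. Qed.
Lemma quo_add0 : left_id (quo_class 0) quo_add.
Proof. by elim/quo_ind => ?; rewrite !quo_addE add0r. Qed.
Lemma quo_addN : left_inverse (quo_class 0) quo_opp quo_add.
Proof. by elim/quo_ind => ?; rewrite quo_oppE !quo_addE addNr. Qed.
HB.instance Definition _ :=
  GRing.isZmodule.Build quo quo_addA quo_addC quo_add0 quo_addN.

Lemma quo_mulA : associative quo_mul.
Proof. by do 3!elim/quo_ind => ?; rewrite !quo_mulE mulrA. Qed.
Lemma quo_mulC : commutative quo_mul.
Proof. by do 2!elim/quo_ind => ?; rewrite !quo_mulE mulrC. Qed.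
Lemma quo_mul1 : left_id (quo_class 1) quo_mul.
Proof. by elim/quo_ind => ?; rewrite !quo_mulE mul1r. Qed.
Lemma quo_mulD : left_distributive quo_mul quo_add.
Proof. by do 3!elim/quo_ind => ?; rewrite !(quo_mulE, quo_addE) mulrDl. Qed.
HB.instance Definition _ :=
  GRing.Zmodule_isComPzRing.Build quo quo_mulA quo_mulC quo_mul1 quo_mulD.

Lemma quo_class_zmod : zmod_morphism quo_class.
Proof.
by move=> a b; rewrite /GRing.add /GRing.opp /= quo_oppE quo_addE.
Qed.
Lemma quo_class_monoid : monoid_morphism quo_class.
Proof. by split=> // a b; rewrite {2}/GRing.mul /= quo_mulE. Qed.
HB.instance Definition _ :=
  GRing.isZmodMorphism.Build A quo quo_class quo_class_zmod.
HB.instance Definition _ :=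
  GRing.isMonoidMorphism.Build A quo quo_class quo_class_monoid.
End QuotientRing.

Definition is_prime (A : comPzRingType) (P : ideal A) : Prop :=
  ~ P 1 /\ forall a b, P (a * b) -> P a \/ P b.

Record spec (A : comPzRingType) := Prime {
  prime_ideal :> ideal A;
  prime_idealP : is_prime prime_ideal }.

HB.instance Definition _ A := gen_eqMixin (spec A).
HB.instance Definition _ A := gen_choiceMixin (spec A).

Lemma spec_ext (A : comPzRingType) (P Q : spec A) :
  (forall a, P a <-> Q a) -> P = Q.
Proof.
case: P Q => [P hP] [Q hQ] /= /ideal_ext e.
by rewrite -e in hQ *; congr Prime; apply: Prop_irrelevance.
Qed.

Lemma prime_mul (A : comPzRingType) (P : spec A) a b :
  ~ P a -> ~ P b -> ~ P (a * b).
Proof. by move=> Pa Pb /(prime_idealP P).2 []. Qed.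

Lemma spec_preim_prime (A B : comPzRingType) (f : {rmorphism A -> B})
  (Q : spec B) : is_prime (ideal_preim f Q).
Proof.
split=> /= [|a b]; first by rewrite rmorph1; apply: (prime_idealP Q).1.
by rewrite rmorphM => /(prime_idealP Q).2.
Qed.

Definition spec_preim (A B : comPzRingType) (f : {rmorphism A -> B})
  (Q : spec B) : spec A := Prime (spec_preim_prime f Q).

Section Localization.
Variables (A : comPzRingType) (P : spec A).

Definition denom := {s : A | ~ P s}.
HB.instance Definition _ := gen_eqMixin denom.
HB.instance Definition _ := gen_choiceMixin denom.

Definition denom1 : denom := exist _ 1 (prime_idealP P).1.
Definition denomM (s t : denom) : denom :=
  exist _ (sval s * sval t) (prime_mul (svalP s) (svalP t)).

Definition loc_equiv (x y : A * denom) : bool :=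
  `[< exists2 u, ~ P u &
      u * (x.1 * sval y.2) = u * (y.1 * sval x.2) >].

Lemma loc_equiv_refl : reflexive loc_equiv.
Proof. by move=> x; apply/asboolP; exists 1 => //; apply: (prime_idealP P).1. Qed.
Lemma loc_equiv_sym : symmetric loc_equiv.
Proof. by move=> x y; apply/asboolP/asboolP => -[u Pu e]; exists u. Qed.
Lemma loc_equiv_trans : transitive loc_equiv.
Proof.
move=> [b [t Pt]] [a [s Ps]] [c [r Pr]] /asboolP /= [u Pu e] /asboolP /= [v Pv e'].
apply/asboolP; exists (u * v * t) => /=; first by do !apply: prime_mul.
have -> : u * v * t * (a * r) = v * r * (u * (a * t)) by ring.
have -> : u * v * t * (c * s) = u * s * (v * (c * t)) by ring.
by rewrite e -e'; ring.
Qed.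

Canonical loc_equiv_rel :=
  EquivRel loc_equiv loc_equiv_refl loc_equiv_sym loc_equiv_trans.

Definition loc := {eq_quot loc_equiv}.
HB.instance Definition _ := Choice.on loc.
HB.instance Definition _ := EqQuotient.on loc.

Definition frac (a : A) (s : denom) : loc := \pi_loc (a, s).

Lemma fracP a s b t : frac a s = frac b t <->
  exists2 u, ~ P u & u * (a * sval t) = u * (b * sval s).
Proof. by split => [/eqmodP/asboolP|h] //; apply/eqmodP/asboolP. Qed.

Lemma frac_eq a s b t : a * sval t = b * sval s -> frac a s = frac b t.
Proof.
by move=> e; apply/fracP; exists 1; rewrite ?e //; apply: (prime_idealP P).1.
Qed.

Lemma loc_ind (Q : loc -> Prop) : (forall a s, Q (frac a s)) -> forall x, Q x.
Proof. by move=> h; elim/quotW => -[]. Qed.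

Lemma frac_repr a s : exists2 u, ~ P u &
  u * ((repr (frac a s)).1 * sval s) = u * (a * sval (repr (frac a s)).2).
Proof. by apply/fracP; rewrite /frac -surjective_pairing reprK. Qed.

Definition loc_opp (x : loc) : loc := frac (- (repr x).1) (repr x).2.
Definition loc_add (x y : loc) : loc :=
  frac ((repr x).1 * sval (repr y).2 + (repr y).1 * sval (repr x).2)
       (denomM (repr x).2 (repr y).2).
Definition loc_mul (x y : loc) : loc :=
  frac ((repr x).1 * (repr y).1) (denomM (repr x).2 (repr y).2).

Lemma loc_oppE a s : loc_opp (frac a s) = frac (- a) s.
Proof.
by apply/fracP; have [u Pu e] := frac_repr a s; exists u; rewrite // !mulNr !mulrN e.
Qed.

Lemma loc_addE a s b t : loc_add (frac a s) (frac b t) =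
  frac (a * sval t + b * sval s) (denomM s t).
Proof.
apply/fracP; have [u Pu] := frac_repr a s; have [v Pv] := frac_repr b t.
case: (repr _) => c [r Pr]; case: (repr _) => d [q Pq] /= e e'.
case: s t e e' => [s Ps] [t Pt] /= e e'.
exists (u * v); first exact: prime_mul.
transitivity (u * (d * s) * (v * r * t) + v * (c * t) * (u * q * s)); first by ring.
by rewrite e e'; ring.
Qed.

Lemma loc_mulE a s b t : loc_mul (frac a s) (frac b t) = frac (a * b) (denomM s t).
Proof.
apply/fracP; have [u Pu] := frac_repr a s; have [v Pv] := frac_repr b t.
case: (repr _) => c [r Pr]; case: (repr _) => d [q Pq] /= e e'.
case: s t e e' => [s Ps] [t Pt] /= e e'.
exists (u * v); first exact: prime_mul.
transitivity (u * (d * s) * (v * (c * t))); first by ring.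
by rewrite e e'; ring.
Qed.

Lemma loc_addA : associative loc_add.
Proof. by do 3!elim/loc_ind => ? ?; rewrite !loc_addE; apply: frac_eq => /=; ring. Qed.
Lemma loc_addC : commutative loc_add.
Proof. by do 2!elim/loc_ind => ? ?; rewrite !loc_addE; apply: frac_eq => /=; ring. Qed.
Lemma loc_add0 : left_id (frac 0 denom1) loc_add.
Proof. by elim/loc_ind => ? ?; rewrite !loc_addE; apply: frac_eq => /=; ring. Qed.
Lemma loc_addN : left_inverse (frac 0 denom1) loc_opp loc_add.
Proof. by elim/loc_ind => ? ?; rewrite loc_oppE !loc_addE; apply: frac_eq => /=; ring. Qed.
HB.instance Definition _ :=
  GRing.isZmodule.Build loc loc_addA loc_addC loc_add0 loc_addN.

Lemma loc_mulA : associative loc_mul.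
Proof. by do 3!elim/loc_ind => ? ?; rewrite !loc_mulE; apply: frac_eq => /=; ring. Qed.
Lemma loc_mulC : commutative loc_mul.
Proof. by do 2!elim/loc_ind => ? ?; rewrite !loc_mulE; apply: frac_eq => /=; ring. Qed.
Lemma loc_mul1 : left_id (frac 1 denom1) loc_mul.
Proof. by elim/loc_ind => ? ?; rewrite !loc_mulE; apply: frac_eq => /=; ring. Qed.
Lemma loc_mulD : left_distributive loc_mul loc_add.
Proof.
by do 3!elim/loc_ind => ? ?; rewrite !(loc_mulE, loc_addE); apply: frac_eq => /=; ring.
Qed.
HB.instance Definition _ :=
  GRing.Zmodule_isComPzRing.Build loc loc_mulA loc_mulC loc_mul1 loc_mulD.

Lemma fracD a s b t : frac a s + frac b t =
  frac (a * sval t + b * sval s) (denomM s t).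
Proof. exact: loc_addE. Qed.
Lemma fracN a s : - frac a s = frac (- a) s.
Proof. exact: loc_oppE. Qed.
Lemma fracM a s b t : frac a s * frac b t = frac (a * b) (denomM s t).
Proof. exact: loc_mulE. Qed.

Definition loc_in (a : A) : loc := frac a denom1.

Lemma loc_in_zmod : zmod_morphism loc_in.
Proof. by move=> a b; rewrite /loc_in fracN fracD; apply: frac_eq => /=; ring. Qed.
Lemma loc_in_monoid : monoid_morphism loc_in.
Proof. by split=> // a b; rewrite /loc_in fracM; apply: frac_eq => /=; ring. Qed.
HB.instance Definition _ := GRing.isZmodMorphism.Build A loc loc_in loc_in_zmod.
HB.instance Definition _ := GRing.isMonoidMorphism.Build A loc loc_in loc_in_monoid.
End Localization.

(* The homomorphism A_P -> B_Q, a / s |-> f a / f s. *)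
Section LocMap.
Variables (A B : comPzRingType) (f : {rmorphism A -> B}) (P : spec A) (Q : spec B).
Hypothesis fPQ : forall s, ~ P s -> ~ Q (f s).

Definition denom_map (s : denom P) : denom Q := exist _ (f (sval s)) (fPQ (svalP s)).

Definition loc_map (x : loc P) : loc Q :=
  frac (f (repr x).1) (denom_map (repr x).2).

Lemma loc_mapE a s : loc_map (frac a s) = frac (f a) (denom_map s).
Proof.
apply/fracP; have [u Pu e] := frac_repr a s.
by exists (f u) => /=; [apply: fPQ|rewrite -!rmorphM e].
Qed.

Lemma loc_map_zmod : zmod_morphism loc_map.
Proof.
elim/loc_ind => a s; elim/loc_ind => b t.
rewrite fracN fracD !loc_mapE fracN fracD; apply: frac_eq => /=.
by rewrite !(rmorphM, rmorphD, rmorphN).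
Qed.
Lemma loc_map_monoid : monoid_morphism loc_map.
Proof.
split; first by rewrite loc_mapE; apply: frac_eq; rewrite /= !rmorph1.
elim/loc_ind => a s; elim/loc_ind => b t.
by rewrite fracM !loc_mapE fracM; apply: frac_eq; rewrite /= !rmorphM.
Qed.
HB.instance Definition _ := GRing.isZmodMorphism.Build (loc P) (loc Q) loc_map loc_map_zmod.
HB.instance Definition _ := GRing.isMonoidMorphism.Build (loc P) (loc Q) loc_map loc_map_monoid.
End LocMap.

Section SpecTopology.
Variable A : comPzRingType.

Definition zeros (H : ideal A) : set (spec A) :=
  [set P | forall a, H a -> P a].

Definition zariski_open (U : set (spec A)) : Prop :=
  exists H : ideal A, U = ~` zeros H.

Lemma zariski_openT : zariski_open setT.
Proof.
exists (ideal_gen setT); apply/esym/seteqP; split=> // P _ /(_ 1) h.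
by apply: (prime_idealP P).1; apply: h => H; apply.
Qed.

Lemma zariski_openI : setI_closed zariski_open.
Proof.
move=> _ _ [H ->] [K ->].
exists (ideal_gen [set c | exists a b, [/\ H a, K b & c = a * b]]).
apply/seteqP; split=> P /=.
  move=> [/existsNP[a /not_implyP[Ha Pa]] /existsNP[b /not_implyP[Kb Pb]]] h.
  by apply: (prime_mul Pa Pb); apply: h => L; apply; exists a, b.
move=> h; split=> hP; apply: h => c; apply=> _ [a [b [Ha Kb ->]]].
  by rewrite mulrC; apply/idealM/hP.
exact/idealM/hP.
Qed.

Lemma zariski_open_bigU (I : Type) (U : I -> set (spec A)) :
  (forall i, zariski_open (U i)) -> zariski_open (\bigcup_i U i).
Proof.
move=> oU; exists (ideal_gen (\bigcup_(i in setT)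
  [set a | exists2 H : ideal A, U i = ~` zeros H & H a])).
apply/seteqP; split=> P /=.
  move=> [i _]; have [H e] := oU i; rewrite e => Ui h; apply: Ui => a Ha.
  by apply: h => L; apply; exists i => //; exists H.
move=> h; apply: contrapT => hU; apply: h => c; apply=> a [i _ [H e Ha]].
apply: contrapT => Pa; apply: hU; exists i => //; rewrite e => /(_ a Ha).
exact: Pa.
Qed.

HB.instance Definition _ := isOpenTopological.Build (spec A)
  zariski_openT zariski_openI zariski_open_bigU.
End SpecTopology.

Record opens (X : topologicalType) := Opens {
  oset :> set X;
  opensP : open oset }.

Definition sub_incl (X : topologicalType) (U V : set X) (VU : V `<=` U) (x : V) : U :=
  exist _ (val x) (mem_set (VU _ (set_valP x))).

Definition opens_preim (X Y : topologicalType) (f : X -> Y) (cf : continuous f)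
  (V : opens Y) : opens X :=
  Opens ((continuousP f).1 cf V (opensP V)).

Section DependentFunctions.
Variables (T : Type) (F : T -> comPzRingType).
Definition dprod := forall x : T, F x.
HB.instance Definition _ := gen_eqMixin dprod.
HB.instance Definition _ := gen_choiceMixin dprod.

Lemma dprodP (s t : dprod) : (forall x, s x = t x) -> s = t.
Proof. exact: functional_extensionality_dep. Qed.

Definition dprod_zero : dprod := fun=> 0.
Definition dprod_one : dprod := fun=> 1.
Definition dprod_opp (s : dprod) : dprod := fun x => - s x.
Definition dprod_add (s t : dprod) : dprod := fun x => s x + t x.
Definition dprod_mul (s t : dprod) : dprod := fun x => s x * t x.

Lemma dprod_addA : associative dprod_add.
Proof. by move=> ? ? ?; apply: dprodP => x; apply: addrA. Qed.
Lemma dprod_addC : commutative dprod_add.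
Proof. by move=> ? ?; apply: dprodP => x; apply: addrC. Qed.
Lemma dprod_add0 : left_id dprod_zero dprod_add.
Proof. by move=> ?; apply: dprodP => x; apply: add0r. Qed.
Lemma dprod_addN : left_inverse dprod_zero dprod_opp dprod_add.
Proof. by move=> ?; apply: dprodP => x; apply: addNr. Qed.
HB.instance Definition _ :=
  GRing.isZmodule.Build dprod dprod_addA dprod_addC dprod_add0 dprod_addN.

Lemma dprod_mulA : associative dprod_mul.
Proof. by move=> ? ? ?; apply: dprodP => x; apply: mulrA. Qed.
Lemma dprod_mulC : commutative dprod_mul.
Proof. by move=> ? ?; apply: dprodP => x; apply: mulrC. Qed.
Lemma dprod_mul1 : left_id dprod_one dprod_mul.
Proof. by move=> ?; apply: dprodP => x; apply: mul1r. Qed.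
Lemma dprod_mulD : left_distributive dprod_mul dprod_add.
Proof. by move=> ? ? ?; apply: dprodP => x; apply: mulrDl. Qed.
HB.instance Definition _ :=
  GRing.Zmodule_isComPzRing.Build dprod dprod_mulA dprod_mulC dprod_mul1 dprod_mulD.
End DependentFunctions.

Section StructureSheaf.
Variable A : comPzRingType.
Implicit Types U V W : opens (spec A).

Definition germs U : comPzRingType := dprod (fun x : U => loc (val x)).

(* Hartshorne's structure sheaf: s is locally a quotient a / f of elements of A. *)
Definition locally_frac U (s : germs U) : Prop :=
  forall x : U, exists W a f, oset W (val x) /\
    forall y : U, oset W (val y) ->
      exists hf : ~ val y f, s y = frac a (exist _ f hf).

Definition regular U : {pred germs U} := fun s => `[< locally_frac s >].

Lemma opensI_subproof (X : topologicalType) (U V : opens X) : open (U `&` V).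
Proof. exact: openI (opensP U) (opensP V). Qed.
Definition opensI (X : topologicalType) (U V : opens X) : opens X :=
  Opens (opensI_subproof U V).
Definition opensT (X : topologicalType) : opens X := Opens (@openT X).

Lemma locally_frac2 U (op : forall x : U, loc (val x) -> loc (val x) -> loc (val x))
  (s t : germs U) :
  (forall a f b g, exists c h, forall (x : U) (hf : ~ val x f) (hg : ~ val x g),
     exists hh : ~ val x h,
      op x (frac a (exist _ f hf)) (frac b (exist _ g hg)) = frac c (exist _ h hh)) ->
  locally_frac s -> locally_frac t -> locally_frac (fun x => op x (s x) (t x)).
Proof.
move=> hop hs ht x.
have [W [a [f [Wx sW]]]] := hs x; have [W' [b [g [Wx' tW]]]] := ht x.
have [c [h ch]] := hop a f b g.
exists (opensI W W'), c, h; split=> // y [Wy Wy'].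
have [hf ->] := sW y Wy; have [hg ->] := tW y Wy'.
exact: ch.
Qed.

Lemma regular_subring U : subring_closed (@regular U).
Proof.
split.
- apply/asboolP => x; exists (opensT _), 1, 1; split=> // y _.
  by exists (prime_idealP (val y)).1; apply: frac_eq.
- move=> s t /asboolP hs /asboolP ht; apply/asboolP.
  apply: (@locally_frac2 U (fun x u v => u - v)) hs ht => a f b g.
  exists (a * g - b * f), (f * g) => x hf hg; exists (prime_mul hf hg).
  by rewrite fracN fracD; apply: frac_eq => /=; ring.
- move=> s t /asboolP hs /asboolP ht; apply/asboolP.
  apply: (@locally_frac2 U (fun x u v => u * v)) hs ht => a f b g.
  by exists (a * b), (f * g) => x hf hg; exists (prime_mul hf hg); rewrite fracM; apply: frac_eq.
Qed.

Record spec_sections U := SpecSection {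
  germ_of :> germs U;
  germ_ofP : regular germ_of }.
HB.instance Definition _ U := [isSub for @germ_of U].
HB.instance Definition _ U := [Choice of spec_sections U by <:].
HB.instance Definition _ U := GRing.SubChoice_isSubComPzRing.Build
  (germs U) (@regular U) (spec_sections U) (@regular_subring U).

Lemma sectionP U (s t : spec_sections U) :
  (forall x, germ_of s x = germ_of t x) -> s = t.
Proof. by move=> h; apply: val_inj; apply: dprodP. Qed.
End StructureSheaf.

Section RingedSpaces.

Record ringed_space := RingedSpace {
  rs_top :> topologicalType;
  O_ : opens rs_top -> comPzRingType;
  res : forall U V : opens rs_top, V `<=` U -> {rmorphism O_ U -> O_ V};
  res_id : forall (U : opens rs_top) (h : U `<=` U) s, res h s = s;
  res_comp : forall (U V W : opens rs_top) (VU : V `<=` U) (WV : W `<=` V) (WU : W `<=` U) s,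
    res WV (res VU s) = res WU s;
  sheafP : forall (I : Type) (U : opens rs_top) (V : I -> opens rs_top)
      (VU : forall i, V i `<=` U), U `<=` \bigcup_i V i ->
    forall s : forall i, O_ (V i),
    (forall i j (W : opens rs_top) (Wi : W `<=` V i) (Wj : W `<=` V j),
       res Wi (s i) = res Wj (s j)) ->
    exists! t : O_ U, forall i, res (VU i) t = s i }.

(* "The germ of s at x is a unit of the stalk at x." *)
Definition germ_unit (X : ringed_space) (U : opens X) (s : O_ U) (x : X) : Prop :=
  exists (V : opens X) (VU : V `<=` U) (t : O_ V), oset V x /\ res VU s * t = 1.

(* Every stalk is a local ring: 1 <> 0 in it, and a or 1 - a is a unit for
   each of its elements a. *)
Definition local_stalks (X : ringed_space) : Prop :=
  forall (x : X) (U : opens X), oset U x ->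
    (1 : O_ U) <> 0 /\ forall s : O_ U, germ_unit s x \/ germ_unit (1 - s) x.

Record lr_space := LRSpace {
  lr_rs :> ringed_space;
  lr_local : local_stalks lr_rs }.

(* The condition [mor_local] says that the maps of stalks are local. *)
Record lr_mor (X Y : lr_space) := LRMor {
  mor_fun :> X -> Y;
  mor_cts : continuous mor_fun;
  mor_sharp : forall V : opens Y, {rmorphism O_ V -> O_ (opens_preim mor_cts V)};
  mor_nat : forall (V W : opens Y) (WV : W `<=` V)
      (h : opens_preim mor_cts W `<=` opens_preim mor_cts V) (s : O_ V),
    mor_sharp W (res WV s) = res h (mor_sharp V s);
  mor_local : forall (V : opens Y) (s : O_ V) (x : X), oset V (mor_fun x) ->
    germ_unit (mor_sharp V s) x -> germ_unit s (mor_fun x) }.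

Arguments mor_cts {X Y} _.

Lemma rmorph_ext (A B : comPzRingType) (f g : {rmorphism A -> B}) : f =1 g -> f = g.
Proof.
case: f g => [f [[f1] [f2]]] [g [[g1] [g2]]] /= /funext e.
move: f1 f2 g1 g2; rewrite e => f1 f2 g1 g2.
by rewrite (Prop_irrelevance f1 g1) (Prop_irrelevance f2 g2).
Qed.

Lemma lr_mor_ext (X Y : lr_space) (f g : lr_mor X Y) :
  (forall x, f x = g x) ->
  (forall (V : opens Y) (h : opens_preim (mor_cts g) V `<=` opens_preim (mor_cts f) V) s,
     res h (mor_sharp f V s) = mor_sharp g V s) ->
  f = g.
Proof.
case: f g => [f cf sf nf lf] [g cg sg ng lg] /= /funext e.
move: cf sf nf lf; rewrite e => cf; rewrite (Prop_irrelevance cf cg) => sf nf lf h.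
have es : sf = sg.
  apply: functional_extensionality_dep => V; apply: rmorph_ext => s.
  by rewrite -(h V (@subset_refl _ _)) res_id.
move: nf lf; rewrite es => nf lf.
by rewrite (Prop_irrelevance nf ng) (Prop_irrelevance lf lg).
Qed.

Section Identity.
Variable X : lr_space.
Lemma lr_id_cts : continuous (@id X). Proof. by move=> x; apply: cvg_id. Qed.
Definition lr_id_sharp (V : opens X) : {rmorphism O_ V -> O_ (opens_preim lr_id_cts V)} :=
  res (@subset_refl _ V : opens_preim lr_id_cts V `<=` V).
Program Definition lr_id : lr_mor X X := @LRMor X X id lr_id_cts lr_id_sharp _ _.
Next Obligation.
by move=> V W WV h s; rewrite /lr_id_sharp !(res_comp _ _ (WV : opens_preim lr_id_cts W `<=` V)).
Qed.
Next Obligation.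
move=> V s x Vx [W [WV [t [Wx e]]]]; exists W, WV, t; split=> //.
by rewrite -e /lr_id_sharp res_comp.
Qed.
End Identity.

Section Composition.
Variables (X Y Z : lr_space) (g : lr_mor Y Z) (f : lr_mor X Y).
Definition lr_comp_fun : X -> Z := fun x => g (f x).
Lemma lr_comp_cts : continuous lr_comp_fun.
Proof. by move=> x; apply: continuous_comp; [apply: mor_cts|apply: mor_cts]. Qed.
Lemma lr_comp_sub (V : opens Z) :
  opens_preim lr_comp_cts V `<=` opens_preim (mor_cts f) (opens_preim (mor_cts g) V).
Proof. by []. Qed.
Definition lr_comp_sharp (V : opens Z) : {rmorphism O_ V -> O_ (opens_preim lr_comp_cts V)} :=
  res (lr_comp_sub (V := V)) \o (mor_sharp f (opens_preim (mor_cts g) V) \o mor_sharp g V).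
Program Definition lr_comp : lr_mor X Z := @LRMor X Z lr_comp_fun lr_comp_cts lr_comp_sharp _ _.
Next Obligation.
move=> V W WV h s; rewrite /lr_comp_sharp /=.
have hg : opens_preim (mor_cts g) W `<=` opens_preim (mor_cts g) V by move=> ? /WV.
have hf : opens_preim (mor_cts f) (opens_preim (mor_cts g) W) `<=`
          opens_preim (mor_cts f) (opens_preim (mor_cts g) V) by move=> ? /WV.
have h' : opens_preim lr_comp_cts W `<=`
          opens_preim (mor_cts f) (opens_preim (mor_cts g) V) by move=> ? /WV.
by rewrite (mor_nat _ hg) (mor_nat _ hf) !(res_comp _ _ h').
Qed.
Next Obligation.
move=> V s x Vx [W [WV [t [Wx e]]]].
apply: (mor_local Vx); apply: mor_local => //.
exists W, WV, t; split=> //; move: e; rewrite /lr_comp_sharp /= res_comp //.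
Qed.
End Composition.

(* The spaces used below are open or closed subschemes of affine schemes, and
   schemes are a full subcategory of locally ringed spaces, so this is also the
   notion of scheme isomorphism. *)
Definition lr_iso (X Y : lr_space) (f : lr_mor X Y) : Prop :=
  exists g : lr_mor Y X, lr_comp f g = lr_id Y /\ lr_comp g f = lr_id X.

Definition isomorphic (X Y : lr_space) : Prop := exists f : lr_mor X Y, lr_iso f.

(* For immersions i : X' -> X and j : Y' -> Y: f maps the subscheme X' of X to
   the subscheme Y' of Y, and the morphism X' -> Y' obtained by restricting f
   is an isomorphism (it is unique since j is a monomorphism). *)
Definition restricts_to_iso (X Y X' Y' : lr_space) (f : lr_mor X Y)
    (i : lr_mor X' X) (j : lr_mor Y' Y) : Prop :=
  exists g : lr_mor X' Y', lr_comp j g = lr_comp f i /\ lr_iso g.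

End RingedSpaces.

Section OpenSubspace.
Variables (X : lr_space) (U : opens X).

Definition open_sub_top : topologicalType := set_type U.
Implicit Types V W : opens open_sub_top.

Lemma open_img_subproof V : open ([set val x | x in oset V] : set X).
Proof.
have [B oB e] := opensP V; suff -> : [set val x | x in oset V] = B `&` U :> set X.
  by apply: openI => //; apply: opensP.
apply/seteqP; split=> [_ [y Vy <-]|x [Bx Ux]].
  by split; [move: Vy; rewrite -e|apply: set_valP].
by exists (exist _ x (mem_set Ux)) => //; rewrite -e.
Qed.
Definition open_img V : opens X := Opens (@open_img_subproof V).

Lemma open_imgS V W : W `<=` V -> open_img W `<=` open_img V.
Proof. exact: image_subset. Qed.

Lemma open_img_val V (y : open_sub_top) : oset (open_img V) (val y) -> oset V y.
Proof. by move=> [z Vz /val_inj <-]. Qed.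

Lemma open_img_preim_subproof (W : opens X) :
  open ((fun y : open_sub_top => val y) @^-1` W).
Proof. by exists (oset W) => //; apply: opensP. Qed.
Definition open_trace (W : opens X) : opens open_sub_top :=
  Opens (open_img_preim_subproof W).

Lemma open_img_trace (W : opens X) : open_img (open_trace W) `<=` W.
Proof. by move=> _ [y Wy <-]. Qed.

Lemma open_trace_img (W : opens X) V :
  W `<=` open_img V -> W `<=` open_img (open_trace W).
Proof. by move=> WV x Wx; have [y Vy e] := WV x Wx; exists y => //=; rewrite e. Qed.

Program Definition open_sub_rs : ringed_space :=
  @RingedSpace open_sub_top (fun V => O_ (open_img V))
    (fun V W WV => res (open_imgS WV)) _ _ _.
Next Obligation. by move=> *; rewrite res_id. Qed.
Next Obligation. by move=> *; apply: res_comp. Qed.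
Next Obligation.
move=> I V W WV cov s hs.
apply: (@sheafP X I (open_img V) (fun i => open_img (W i)) (fun i => open_imgS (WV i))).
  by move=> _ [y Vy <-]; have [i _ Wy] := cov y Vy; exists i => //; exists y.
move=> i j T Ti Tj.
have tWi : open_trace T `<=` W i by move=> y /Ti /open_img_val.
have tWj : open_trace T `<=` W j by move=> y /Tj /open_img_val.
have h := open_trace_img Ti.
by rewrite -(res_comp (open_imgS tWi) h) (hs i j _ tWi tWj) res_comp.
Qed.

Lemma open_sub_germ V (s : O_ (open_img V)) (y : open_sub_top) :
  germ_unit s (val y) <-> @germ_unit open_sub_rs V s y.
Proof.
split=> -[W [WV [t [Wy e]]]].
  have h : open_trace W `<=` V by move=> z /WV /open_img_val.
  exists (open_trace W), h, (res (@open_img_trace W) t); split=> //=.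
  rewrite -(res_comp WV (@open_img_trace W)) -rmorphM.
  by rewrite e rmorph1.
by exists (open_img W), (open_imgS WV), t; split=> //; exists y.
Qed.

Program Definition open_sub : lr_space := @LRSpace open_sub_rs _.
Next Obligation.
move=> y V Vy; have [|h1 h2] := @lr_local X (val y) (open_img V); first by exists y.
by split=> // s; have [/open_sub_germ|/open_sub_germ] := h2 s; [left|right].
Qed.

Lemma open_incl_cts : continuous (fun y : open_sub => val y : X).
Proof. exact: initial_continuous. Qed.
Lemma open_incl_sub (V : opens X) : open_img (opens_preim open_incl_cts V) `<=` V.
Proof. by move=> _ [y Vy <-]. Qed.
Program Definition open_incl : lr_mor open_sub X :=
  @LRMor open_sub X (fun y => val y) open_incl_cts
    (fun V : opens X => @res X V (open_img (opens_preim open_incl_cts V)) (@open_incl_sub V)) _ _.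
Next Obligation.
move=> V W WV h s; have hh : open_img (opens_preim open_incl_cts W) `<=` V.
  by move=> _ [y Vy <-]; apply: WV.
by rewrite /= !(res_comp _ _ hh).
Qed.
Next Obligation.
move=> V s y Vy /open_sub_germ [W [WV [t [Wy e]]]].
have h : W `<=` V by move=> x /WV; apply: open_incl_sub.
by exists W, h, t; split=> //; rewrite -e res_comp.
Qed.
End OpenSubspace.

Section Spec.
Variable A : comPzRingType.
Implicit Types U V W : opens (spec A).

Definition spec_res_fun U V (VU : V `<=` U) (s : spec_sections U) : germs V :=
  fun x : V => germ_of s (sub_incl VU x).

Lemma spec_res_regular U V (VU : V `<=` U) s : regular (spec_res_fun VU s).
Proof.
apply/asboolP => x; have /asboolP /(_ (sub_incl VU x)) := germ_ofP s.
by move=> [W [a [f [Wx sW]]]]; exists W, a, f; split=> // y Wy; exact: (sW (sub_incl VU y) Wy).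
Qed.

Definition spec_res U V (VU : V `<=` U) (s : spec_sections U) : spec_sections V :=
  SpecSection (spec_res_regular VU s).

Lemma spec_res_zmod U V (VU : V `<=` U) : zmod_morphism (spec_res VU).
Proof. by move=> s t; apply: sectionP. Qed.
Lemma spec_res_monoid U V (VU : V `<=` U) : monoid_morphism (spec_res VU).
Proof. by split=> [|s t]; apply: sectionP. Qed.
HB.instance Definition _ U V (VU : V `<=` U) :=
  GRing.isZmodMorphism.Build _ _ (spec_res VU) (spec_res_zmod VU).
HB.instance Definition _ U V (VU : V `<=` U) :=
  GRing.isMonoidMorphism.Build _ _ (spec_res VU) (spec_res_monoid VU).

Lemma germ_irr U (s : germs U) (P : spec A) (h h' : P \in oset U) :
  s (exist _ P h) = s (exist _ P h').
Proof. by rewrite (Prop_irrelevance h h'). Qed.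

Lemma germ_val U (s : germs U) (x : U) (h : val x \in oset U) :
  s (exist _ (val x) h) = s x.
Proof. by case: x h => P h h'; apply: germ_irr. Qed.

Lemma spec_sheaf (I : Type) U (V : I -> opens (spec A))
    (VU : forall i, V i `<=` U) : U `<=` \bigcup_i V i ->
  forall s : forall i, spec_sections (V i),
  (forall i j W (Wi : W `<=` V i) (Wj : W `<=` V j),
     spec_res Wi (s i) = spec_res Wj (s j)) ->
  exists! t : spec_sections U, forall i, spec_res (VU i) t = s i.
Proof.
move=> cov s hs.
have hs' i j (P : spec A) (Pi : P \in oset (V i)) (Pj : P \in oset (V j)) :
  germ_of (s i) (exist _ P Pi) = germ_of (s j) (exist _ P Pj).
  pose W := opensI (V i) (V j).
  have Wi : W `<=` V i by move=> ? [].
  have Wj : W `<=` V j by move=> ? [].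
  have WP : P \in oset W by apply: mem_set; split; apply: set_mem.
  have := congr1 (fun u : spec_sections W => germ_of u (exist _ P WP)) (hs i j W Wi Wj).
  rewrite /= /spec_res_fun /sub_incl /= => e.
  by rewrite (germ_irr _ _ (mem_set (Wi P (set_valP (exist _ P WP))))) e; apply: germ_irr.
have ix (x : U) : {i | oset (V i) (val x)}.
  by apply: cid; have [i _ h] := cov _ (set_valP x); exists i.
pose t : germs U := fun x => germ_of (s (sval (ix x))) (exist _ (val x) (mem_set (svalP (ix x)))).
have tE i (x : U) (h : val x \in oset (V i)) : t x = germ_of (s i) (exist _ (val x) h).
  exact: hs'.
have t_reg : regular t.
  apply/asboolP => x; have Vx := svalP (ix x); set i := sval _ in Vx.
  have /asboolP /(_ (exist _ (val x) (mem_set Vx))) := germ_ofP (s i).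
  move=> [W [a [f [Wx sW]]]]; exists (opensI W (V i)), a, f; split=> // y [Wy Viy].
  by rewrite (tE i y (mem_set Viy)); exact: (sW (exist _ (val y) (mem_set Viy)) Wy).
exists (SpecSection t_reg); split.
  move=> i; apply: sectionP => -[P Pi].
  exact: (tE i (sub_incl (VU i) (exist _ P Pi)) Pi).
move=> t' ht'; apply: sectionP => x /=.
rewrite (tE _ x (mem_set (svalP (ix x)))) -ht' /= /spec_res_fun /=.
exact: germ_val.
Qed.

Program Definition spec_rs : ringed_space :=
  @RingedSpace (spec A) (fun U => spec_sections U)
    (fun U V VU => spec_res VU) _ _ _.
Next Obligation.
by move=> U h s; apply: sectionP => -[P hP]; rewrite /= /spec_res_fun; apply: germ_irr.
Qed.
Next Obligation.
by move=> U V W VU WV WU s; apply: sectionP => -[P hP] /=; rewrite /spec_res_fun /=; apply: germ_irr.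
Qed.
Next Obligation. exact: spec_sheaf. Qed.

Program Definition basic_open (f : A) : opens (spec A) :=
  @Opens (spec A) [set P | ~ P f] _.
Next Obligation.
move=> f; exists (ideal_gen [set f]); apply/seteqP; split=> P /=.
  by move=> Pf h; apply: Pf; apply: h => H; apply.
by move=> h Pf; apply: h => a; apply=> _ ->.
Qed.

Lemma frac_unit (P : spec A) a s : (exists t : loc P, frac a s * t = 1) <-> ~ P a.
Proof.
split=> [[t]|Pa]; last first.
  by exists (frac (sval s) (exist _ a Pa)); rewrite fracM; apply: frac_eq => /=; ring.
elim/loc_ind: t => b t; rewrite fracM => /fracP [u Pu /= e] Pa.
case: s t e => [s Ps] [t Pt] /= e.
apply: (prime_mul Pu (prime_mul Ps Pt)).
have -> : u * (s * t) = u * (1 * (s * t)) by ring.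
by rewrite -e mulrA mulr1 mulrA mulrAC; apply: idealM.
Qed.

Definition const_frac U (a f : A) (h : forall x : U, ~ val x f) : germs U :=
  fun x => frac a (exist _ f (h x)).

Lemma const_frac_regular U a f h : regular (@const_frac U a f h).
Proof. by apply/asboolP => x; exists (opensT _), a, f; split=> // y _; exists (h y). Qed.

Lemma spec_germ_unit U (s : spec_sections U) (x : U) :
  @germ_unit spec_rs U s (val x) <-> exists t : loc (val x), germ_of s x * t = 1.
Proof.
split.
  move=> [W [WU [t [Wx e]]]].
  have := congr1 (fun u : spec_sections W => germ_of u (exist _ (val x) (mem_set Wx))) e.
  case: x Wx => P h /= Wx; rewrite /spec_res_fun /sub_incl /= => e'.
  exists (germ_of t (exist _ P (mem_set Wx))); rewrite -[RHS]e' -/(_ * _).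
  by congr (_ * _); apply: germ_irr.
have /asboolP /(_ x) [W [a [f [Wx sW]]]] := germ_ofP s.
have [hf ->] := sW x Wx => /frac_unit Pa.
pose T := opensI (opensI W U) (basic_open a).
have TU : T `<=` U by move=> P [[]].
have hT (y : T) : ~ val y a by have [] := set_valP y.
exists T, TU, (SpecSection (@const_frac_regular T f a hT)); split.
  by do !split => //; apply: set_valP.
apply: sectionP => y /=; have [[Wy _] ya] := set_valP y.
rewrite /GRing.mul /= /dprod_mul /= /spec_res_fun.
have [hy ->] := sW (sub_incl TU y) Wy.
by rewrite fracM; apply: frac_eq => /=; ring.
Qed.

Program Definition Spec : lr_space := @LRSpace spec_rs _.
Next Obligation.
move=> P U UP; pose x : U := exist _ P (mem_set UP); split.
  move=> e; have := congr1 (fun u : spec_sections U => germ_of u x) e.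
  move=> /fracP [u Pu /=]; rewrite mul0r mulr0 !mulr1 => u0.
  by apply: Pu; rewrite u0; apply: ideal0.
move=> s.
have us := spec_germ_unit s x; have us' := spec_germ_unit (1 - s) x.
rewrite -/P in us us'.
have /asboolP /(_ x) [W [a [f [Wx sW]]]] := germ_ofP s.
have [hf sx] := sW x Wx.
have [Pa|Pa] := pselect (P a); [right; apply/us'|left; apply/us].
  have -> : germ_of (1 - s) x = frac (f - a) (exist _ f hf).
    transitivity (1 - germ_of s x) => //; rewrite sx /GRing.one /= fracN fracD.
    by apply: frac_eq => /=; ring.
  apply/frac_unit => Pfa; apply: (hf) => /=; rewrite -[f](subrK a).
  exact: idealD.
by rewrite sx; apply/frac_unit.
Qed.
End Spec.

Section SpecMap.
Variables (A B : comPzRingType) (f : {rmorphism A -> B}).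

Lemma spec_preim_cts : continuous (spec_preim f : Spec B -> Spec A).
Proof.
apply/continuousP => _ [H ->].
exists (ideal_gen [set b | exists2 a, H a & b = f a]); apply/seteqP; split=> Q /=.
  by move=> nH h; apply: nH => a Ha /=; apply: h => K; apply; exists a.
by move=> h nH; apply: h => b; apply=> _ [a Ha ->]; apply: nH.
Qed.

Definition loc_at (Q : spec B) : {rmorphism loc (spec_preim f Q) -> loc Q} :=
  @loc_map A B f (spec_preim f Q) Q (fun s h => h).

Section Sharp.
Variable V : opens (Spec A).

Definition preim_point (y : opens_preim spec_preim_cts V) : V :=
  exist _ (spec_preim f (val y)) (mem_set (set_valP y)).

Definition sharp_fun (s : spec_sections V) : germs (opens_preim spec_preim_cts V) :=
  fun y => loc_at (val y) (germ_of s (preim_point y)).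

Lemma sharp_regular s : regular (sharp_fun s).
Proof.
apply/asboolP => y; have /asboolP /(_ (preim_point y)) [W [a [g [Wy sW]]]] := germ_ofP s.
exists (opens_preim spec_preim_cts W), (f a), (f g); split=> // z Wz.
by have [hg e] := sW (preim_point z) Wz; exists hg; rewrite /sharp_fun e [LHS]loc_mapE; apply: frac_eq.
Qed.

Definition spec_sharp (s : spec_sections V) :
    spec_sections (opens_preim spec_preim_cts V) :=
  SpecSection (sharp_regular s).

Lemma spec_sharp_zmod : zmod_morphism spec_sharp.
Proof. by move=> s t; apply: sectionP => y; exact: (rmorphB (loc_at (val y)) (germ_of s (preim_point y)) (germ_of t (preim_point y))). Qed.
Lemma spec_sharp_monoid : monoid_morphism spec_sharp.
Proof.
split=> [|s t]; apply: sectionP => y; first exact: (rmorph1 (loc_at (val y))).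
exact: (rmorphM (loc_at (val y)) (germ_of s (preim_point y)) (germ_of t (preim_point y))).
Qed.
HB.instance Definition _ := GRing.isZmodMorphism.Build _ _ spec_sharp spec_sharp_zmod.
HB.instance Definition _ := GRing.isMonoidMorphism.Build _ _ spec_sharp spec_sharp_monoid.
End Sharp.

Program Definition Spec_map : lr_mor (Spec B) (Spec A) :=
  @LRMor (Spec B) (Spec A) (spec_preim f) spec_preim_cts
    (fun V => spec_sharp (V := V)) _ _.
Next Obligation.
move=> V W WV h s; apply: sectionP => y /=.
rewrite /sharp_fun /spec_res_fun /=; congr (loc_at _ _).
exact: (@germ_irr A V (germ_of s) (spec_preim f (val y))).
Qed.
Next Obligation.
move=> V s Q VQ; pose y : opens_preim spec_preim_cts V := exist _ Q (mem_set VQ).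
move=> /(spec_germ_unit (spec_sharp s) y) u.
apply/(spec_germ_unit s (preim_point y)); move: u => /=.
rewrite /sharp_fun; elim/loc_ind: (germ_of s _) => a g.
by rewrite [loc_at _ _]loc_mapE => /frac_unit h; apply/frac_unit.
Qed.
End SpecMap.

(* The open subscheme Spec A \ V(H) and the closed subscheme V(H), the latter
   being Spec (A / H) with the closed immersion dual to A -> A / H. *)
Section Subschemes.
Variables (A : comPzRingType) (H : ideal A).

Definition zeros_compl : opens (Spec A) :=
  @Opens (Spec A) (~` zeros H) (ex_intro _ H erefl).

Definition open_subscheme : lr_space := open_sub zeros_compl.
Definition open_immersion : lr_mor open_subscheme (Spec A) := open_incl zeros_compl.

Definition closed_subscheme : lr_space := Spec (quo H).
Definition closed_immersion : lr_mor closed_subscheme (Spec A) :=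
  Spec_map (quo_class H).

Lemma closed_immersion_image : range closed_immersion = zeros H :> set (spec A).
Proof.
apply/seteqP; split=> [_ [Q _ <-] a Ha /=|P HP].
  suff -> : quo_class H a = 0 by apply: ideal0.
  by apply/quo_classP; rewrite subr0.
have hP : forall a b, H (a - b) -> P b -> P a.
  by move=> a b /HP Pab Pb; rewrite -[a](subrK b); apply: idealD.
pose K (x : quo H) := P (repr x).
have KE a : K (quo_class H a) <-> P a.
  split; apply: hP; last exact: quo_repr.
  by rewrite -opprB; apply/idealN/quo_repr.
have K0 : K 0 by apply/KE/ideal0.
have KD x y : K x -> K y -> K (x + y).
  elim/quo_ind: x => a; elim/quo_ind: y => b /KE Pa /KE Pb.
  by rewrite -rmorphD; apply/KE/idealD.
have KM x y : K y -> K (x * y).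
  elim/quo_ind: x => a; elim/quo_ind: y => b /KE Pb.
  by rewrite -rmorphM; apply/KE/idealM.
have KP : is_prime (Ideal K0 KD KM).
  split=> [/KE|]; first exact: (prime_idealP P).1.
  elim/quo_ind => a; elim/quo_ind => b /=; rewrite -rmorphM => /KE.
  by move=> /(prime_idealP P).2 [] h; [left|right]; apply/KE.
by exists (Prime KP) => //; apply: spec_ext => a; apply: KE.
Qed.
End Subschemes.

Section RingPullback.
Variables (A B C : comPzRingType).

Definition rpair (f : {rmorphism A -> B}) (g : {rmorphism A -> C}) : A -> B * C :=
  fun a => (f a, g a).

Lemma rpair_zmod f g : zmod_morphism (rpair f g).
Proof. by move=> a b; rewrite /rpair !rmorphB. Qed.
Lemma rpair_monoid f g : monoid_morphism (rpair f g).
Proof. by split=> [|a b]; rewrite /rpair ?rmorph1 ?rmorphM. Qed.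
HB.instance Definition _ f g := GRing.isZmodMorphism.Build _ _ (rpair f g) (rpair_zmod f g).
HB.instance Definition _ f g := GRing.isMonoidMorphism.Build _ _ (rpair f g) (rpair_monoid f g).
End RingPullback.

Definition is_pullback (A B C D : comPzRingType) (f : {rmorphism A -> B})
    (g : {rmorphism A -> C}) (u : {rmorphism B -> D}) (v : {rmorphism C -> D}) : Prop :=
  u \o f =1 v \o g /\
  forall (T : comPzRingType) (b : {rmorphism T -> B}) (c : {rmorphism T -> C}),
    u \o b =1 v \o c ->
    exists! h : {rmorphism T -> A}, f \o h =1 b /\ g \o h =1 c.

Definition ring_isomorphic (A B : comPzRingType) : Prop :=
  exists f : {rmorphism A -> B}, bijective f.

Section Duplication.
Variables (R : comPzRingType) (I : ideal R).

Definition dup_pred : {pred R * R} :=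
  fun z => `[< exists r i, I i /\ z = (r, r + i) >].

Lemma dup_subring : subring_closed dup_pred.
Proof.
split.
- by apply/asboolP; exists 1, 0; rewrite addr0; split=> //; apply: ideal0.
- move=> _ _ /asboolP[r [i [Ii ->]]] /asboolP[s [j [Ij ->]]]; apply/asboolP.
  exists (r - s), (i - j); split; first exact: idealB.
  by congr pair => /=; ring.
- move=> _ _ /asboolP[r [i [Ii ->]]] /asboolP[s [j [Ij ->]]]; apply/asboolP.
  exists (r * s), ((r + i) * j + s * i); split; first by apply: idealD; apply: idealM.
  by congr pair => /=; ring.
Qed.

(* R |><| I, as a subring of R x R. *)
Record dup := Dup { dup_val : R * R; dup_valP : dup_pred dup_val }.
HB.instance Definition _ := [isSub for dup_val].
HB.instance Definition _ := [Choice of dup by <:].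
HB.instance Definition _ := GRing.SubChoice_isSubComPzRing.Build
  (R * R)%type dup_pred dup dup_subring.

Definition dup_incl : {rmorphism dup -> R * R} := val.
Definition dup_fst : {rmorphism dup -> R} := fst \o dup_incl.
Definition dup_snd : {rmorphism dup -> R} := snd \o dup_incl.

Lemma dup_diag_subproof (r : R) : dup_pred (r, r).
Proof. by apply/asboolP; exists r, 0; rewrite addr0; split=> //; apply: ideal0. Qed.
Definition dup_diag_fun (r : R) : dup := Dup (dup_diag_subproof r).
Lemma dup_diag_zmod : zmod_morphism dup_diag_fun.
Proof. by move=> r s; apply: val_inj. Qed.
Lemma dup_diag_monoid : monoid_morphism dup_diag_fun.
Proof. by split=> [|r s]; apply: val_inj. Qed.
HB.instance Definition _ := GRing.isZmodMorphism.Build R dup dup_diag_fun dup_diag_zmod.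
HB.instance Definition _ := GRing.isMonoidMorphism.Build R dup dup_diag_fun dup_diag_monoid.
Definition dup_diag : {rmorphism R -> dup} := dup_diag_fun.

(* (0) x I and I x (0). *)
Program Definition zero_times : ideal (R * R)%type :=
  @Ideal (R * R)%type (fun z => z.1 = 0 /\ I z.2) _ _ _.
Next Obligation. by split=> //; apply: ideal0. Qed.
Next Obligation.
by move=> a b [a0 Ia] [b0 Ib] /=; rewrite a0 b0 addr0; split=> //; apply: idealD.
Qed.
Next Obligation. by move=> a b [b0 Ib] /=; rewrite b0 mulr0; split=> //; apply: idealM. Qed.

Program Definition times_zero : ideal (R * R)%type :=
  @Ideal (R * R)%type (fun z => I z.1 /\ z.2 = 0) _ _ _.
Next Obligation. by split=> //; apply: ideal0. Qed.
Next Obligation.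
by move=> a b [Ia a0] [Ib b0] /=; rewrite a0 b0 addr0; split=> //; apply: idealD.
Qed.
Next Obligation. by move=> a b [Ib b0] /=; rewrite b0 mulr0; split=> //; apply: idealM. Qed.

Definition dup_prime1 (P : spec R) : set (R * R) :=
  [set z | exists p x, [/\ P p, I x & z = (p, p + x)]].
Definition dup_prime2 (P : spec R) : set (R * R) :=
  [set z | exists p x, [/\ P p, I x & z = (p + x, p)]].

(* The extended ideal I R_P. *)
Definition loc_ideal (P : spec R) : ideal (loc P) :=
  ideal_gen (loc_in P @` I).

(* u_P x = (x, x + I_P) and v_P (x, y) = (x, y + I_P). *)
Definition pullback_u (P : spec R) :
    {rmorphism loc P -> loc P * quo (loc_ideal P)} :=
  rpair idfun (quo_class (loc_ideal P)).
Definition pullback_v (P : spec R) :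
    {rmorphism loc P * loc P -> loc P * quo (loc_ideal P)} :=
  rpair fst (quo_class (loc_ideal P) \o snd).
End Duplication.

(* P x R and R x P. *)
Definition prime_times (R : comPzRingType) (P : spec R) : spec (R * R)%type :=
  spec_preim fst P.
Definition times_prime (R : comPzRingType) (P : spec R) : spec (R * R)%type :=
  spec_preim snd P.

(* Main.v *)
(* Call f : A -> B bijective from an ideal H of A onto an ideal J of B when it
   restricts to a bijection H -> J.  Every fraction b / g near a prime Q of B
   not containing J can then be rewritten, with c in H such that f c is not in
   Q, as (b f(c)) / (g f(c)), whose numerator and denominator come from H.  So
   A_P -> B_Q is an isomorphism, every prime P of A not containing H has exactly
   one prime over it, and Spec B \ V(J) -> Spec A \ V(H) is an isomorphism.
   The inclusion of the duplication into R x R and the two projections of R x R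
   onto R are bijective between the relevant ideals O_1, O_2 and I, which gives
   (a).  Part (b) comes from R / I = (R |><| I) / (O_1 + O_2).  For (c), the
   localization of the duplication embeds in R_P x R_P, with image the pairs
   whose difference lies in I_P. *)
Require Import Defs.
From HB Require Import structures.
From mathcomp Require Import all_boot all_algebra.
From mathcomp Require Import all_classical.
From mathcomp Require Import topology_structure initial_topology subtype_topology.
From mathcomp Require Import ring.

Set Implicit Arguments.
Unset Strict Implicit.
Unset Printing Implicit Defensive.

Import GRing.Theory.
Local Open Scope classical_set_scope.
Local Open Scope ring_scope.

Arguments mor_cts {X Y} _.

(** * Bijections and inverse ring homomorphisms *)

Lemma inj_surj_bij (T U : Type) (f : T -> U) :
  injective f -> (forall y, exists x, f x = y) -> bijective f.
Proof.
move=> fI fS; pose g y := sval (cid (fS y)).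
by exists g => [x|y]; [apply: fI|]; rewrite /g; case: cid.
Qed.

Lemma cancel_bij_section (T U : Type) (f : T -> U) (g : U -> T) :
  cancel f g -> bijective g -> bijective f.
Proof. by move=> fK [h gK hK]; exists g => // u; apply: (can_inj gK); rewrite fK. Qed.

Section InverseMorphism.
Variables (A B : comPzRingType) (f : {rmorphism A -> B}) (g : B -> A).
Hypotheses (fK : cancel f g) (gK : cancel g f).

Lemma inv_zmod : zmod_morphism g.
Proof. by move=> a b; apply: (can_inj fK); rewrite rmorphB !gK. Qed.
Lemma inv_monoid : monoid_morphism g.
Proof.
by split=> [|a b]; apply: (can_inj fK); rewrite ?rmorph1 ?rmorphM !gK.
Qed.

Definition inv_fun : B -> A := g.
HB.instance Definition _ := GRing.isZmodMorphism.Build B A inv_fun inv_zmod.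
HB.instance Definition _ := GRing.isMonoidMorphism.Build B A inv_fun inv_monoid.
Definition inv_rmorph : {rmorphism B -> A} := inv_fun.
End InverseMorphism.

Lemma bij_rmorph (A B : comPzRingType) (f : {rmorphism A -> B}) :
  bijective f -> exists g : {rmorphism B -> A}, cancel f g /\ cancel g f.
Proof. by case=> g fK gK; exists (inv_rmorph fK gK). Qed.

(** * Local rings and primes under a bijection between two ideals *)

Lemma not_zerosP (A : comPzRingType) (H : ideal A) (P : spec A) :
  ~ zeros H P -> exists2 c, H c & ~ P c.
Proof. by move=> /existsNP[c /not_implyP[Hc Pc]]; exists c. Qed.

Section IdealBijection.
Variables (A B : comPzRingType) (f : {rmorphism A -> B}).
Variables (H : ideal A) (J : ideal B).

Definition ideal_bij : Prop :=
  [/\ forall a, H a -> J (f a),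
      forall a, H a -> f a = 0 -> a = 0 &
      forall b, J b -> exists2 a, H a & f a = b].

Hypothesis HJ : ideal_bij.

Let f_in a : H a -> J (f a). Proof. by case: HJ => h _ _; apply: h. Qed.
Let f_inj a a' : H a -> H a' -> f a = f a' -> a = a'.
Proof.
case: HJ => _ h _ Ha Ha' e; apply/eqP; rewrite -subr_eq0; apply/eqP/h.
  exact: idealB.
by rewrite rmorphB e subrr.
Qed.
(** [J] absorbs multiplication by [B], so multiplying by [f a] with [a] in [H] brings any [b] into
    the image of [H]. This is how elements of [B] are pulled back to [A] below. *)
Let f_surj b a : H a -> exists2 d, H d & f d = b * f a.
Proof. by case: HJ => _ _ h Ha; apply/h/idealM/f_in. Qed.

Lemma loc_map_bij (P : spec A) (Q : spec B)
    (PQ : forall s, ~ P s -> ~ Q (f s)) :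
  (forall a, P a -> Q (f a)) -> ~ zeros J Q -> bijective (loc_map PQ).
Proof.
move=> QP /not_zerosP[j Jj Qj].
have [c Hc fc] : exists2 c, H c & f c = j by case: HJ => _ _; apply.
have Qfc : ~ Q (f c) by rewrite fc.
have lift b : ~ Q b -> exists2 d, H d & f d = b * f c /\ ~ P d.
  move=> Qb; have [d Hd fd] := f_surj b Hc; exists d => //; split=> // /QP.
  by rewrite fd; apply: prime_mul.
apply: inj_surj_bij; last first.
  elim/loc_ind => b [g Qg]; have [d Hd fd] := f_surj b Hc.
  have [e He [fe Pe]] := lift g Qg.
  exists (Defs.frac d (exist _ e Pe)); rewrite loc_mapE; apply: frac_eq => /=.
  by rewrite fd fe; ring.
elim/loc_ind => a [s Ps]; elim/loc_ind => b [t Pt].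
rewrite !loc_mapE => /fracP [u Qu /= e]; apply/fracP => /=.
have [d Hd [fd Pd]] := lift u Qu; exists d => //.
have Hd' x : H (d * x) by rewrite mulrC; apply: idealM.
(* Both sides lie in [H] because [d] does, so the equation may be checked after [f], where [e] gives
   it. *)
by apply: f_inj => //; rewrite !rmorphM fd [u * _]mulrC -!mulrA e.
Qed.

(* The prime over P: for a fixed c in H but not in P, b lies in it iff b f(c) is
   the image of an element of H and P; quantifying over h avoids choosing c. *)
Definition ext_prime_set (P : ideal A) : set B :=
  [set b | forall h, H h -> exists h', [/\ H h', P h' & b * f h = f h']].

Program Definition ext_ideal (P : ideal A) : ideal B :=
  @Ideal B (ext_prime_set P) _ _ _.
Next Obligation.
by move=> P h Hh; exists 0; split; [apply: ideal0..|rewrite mul0r rmorph0].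
Qed.
Next Obligation.
move=> P a b Qa Qb h Hh; have [c [Hc Pc ec]] := Qa h Hh.
have [d [Hd Pd ed]] := Qb h Hh; exists (c + d).
by split; [apply: idealD..|rewrite mulrDl ec ed rmorphD].
Qed.
Next Obligation.
move=> P a b Qb h Hh; have [d Hd fd] := f_surj a Hh.
by have [c [Hc Pc ec]] := Qb d Hd; exists c; rewrite -ec fd; split=> //; ring.
Qed.

Lemma ext_ideal_preim (P : spec A) : ~ zeros H P ->
  forall a, ext_ideal P (f a) <-> P a.
Proof.
move=> /not_zerosP[c Hc Pc] a; split=> [/(_ c Hc) [h [Hh Ph e]]|Pa h Hh].
  have: P (a * c).
    by rewrite (f_inj (idealM a Hc) Hh) // rmorphM.
  by move=> /(prime_idealP P).2 [].
exists (a * h); split; [exact: idealM| |by rewrite rmorphM].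
by rewrite mulrC; apply: idealM.
Qed.

Lemma ext_ideal_prime (P : spec A) : ~ zeros H P -> is_prime (ext_ideal P).
Proof.
move=> PH; split.
  rewrite -(rmorph1 f) => /(ext_ideal_preim PH).
  exact: (prime_idealP P).1.
have notQ b : ~ ext_ideal P b ->
    exists h h', [/\ H h, H h', f h' = b * f h & ~ P h'].
  move=> /existsNP[h /not_implyP[Hh nh]]; have [h' Hh' e] := f_surj b Hh.
  by exists h, h'; split=> // Ph'; apply: nh; exists h'.
move=> b b' Qbb'; apply: contrapT => /not_orP[].
move=> /notQ[h [k [Hh Hk e Pk]]] /notQ[h' [k' [Hh' Hk' e' Pk']]].
apply: (prime_mul Pk Pk').
(* Testing the product against [h * h'] gives [k * k' = l] by injectivity on [H], with [l] in
   [P]. *)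
have [l [Hl Pl el]] := Qbb' (h * h') (idealM h Hh').
rewrite (f_inj (idealM k Hk') Hl) // -el !rmorphM e e'; ring.
Qed.

Definition ext_spec (P : spec A) (PH : ~ zeros H P) : spec B :=
  Prime (ext_ideal_prime PH).

Lemma ext_specK (P : spec A) (PH : ~ zeros H P) : spec_preim f (ext_spec PH) = P.
Proof. by apply: spec_ext => a; apply: ext_ideal_preim. Qed.

Lemma zeros_preim (Q : spec B) : zeros H (spec_preim f Q) <-> zeros J Q.
Proof.
split=> [QH j Jj|QJ a Ha]; last exact/QJ/f_in.
have [c Hc <-] : exists2 c, H c & f c = j by case: HJ => _ _; apply.
exact: QH.
Qed.

(** For [c] in [H] with [f c] outside [Q'], the product [b * f c] comes from [A], where the
    contractions can be compared; primality of [Q'] then cancels [f c]. *)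
Lemma preim_sub (Q Q' : spec B) : ~ zeros J Q' ->
  (forall a, Q (f a) -> Q' (f a)) -> forall b, Q b -> Q' b.
Proof.
rewrite -zeros_preim => /not_zerosP[c Hc Qc] QQ' b Qb.
have [d _ fd] := f_surj b Hc.
have /(prime_idealP Q').2 [] // : Q' (b * f c).
by rewrite -fd; apply: QQ'; rewrite fd mulrC; apply: idealM.
Qed.

Lemma spec_preim_inj (Q Q' : spec B) : ~ zeros J Q ->
  spec_preim f Q = spec_preim f Q' -> Q = Q'.
Proof.
move=> QJ e; have QJ' : ~ zeros J Q' by rewrite -zeros_preim -e zeros_preim.
have e' a : Q (f a) = Q' (f a) by rewrite -[LHS]/(spec_preim f Q a) e.
by apply: spec_ext => b; split; apply: preim_sub => // a; rewrite e'.
Qed.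

(** Outside V([H]) its zeros correspond to those of [K] outside V([J]), which makes the inverse of
    the map on primes continuous. *)
Program Definition contract_in (K : ideal B) : ideal A :=
  @Ideal A [set a | H a /\ K (f a)] _ _ _.
Next Obligation. by move=> K; rewrite /= rmorph0; split; apply: ideal0. Qed.
Next Obligation.
by move=> K a b [Ha Ka] [Hb Kb]; rewrite /= rmorphD; split; apply: idealD.
Qed.
Next Obligation.
by move=> K a b [Hb Kb]; rewrite /= rmorphM; split; apply: idealM.
Qed.

Lemma zeros_contract_in (K : ideal B) (Q : spec B) : ~ zeros J Q ->
  zeros (contract_in K) (spec_preim f Q) <-> zeros K Q.
Proof.
move=> QJ; split=> [QK b Kb|QK a [_ Ka]]; last exact: QK.
have := QJ; rewrite -zeros_preim => /not_zerosP[c Hc Qc].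
have [d Hd fd] := f_surj b Hc.
have /(prime_idealP Q).2 [] // : Q (b * f c).
by rewrite -fd; apply: QK; split=> //; rewrite fd mulrC; apply: idealM.
Qed.
End IdealBijection.

(** * A criterion for isomorphisms of locally ringed spaces *)

Lemma res_eq_bij (X : ringed_space) (U V : opens X) (VU : V `<=` U) :
  U `<=` V -> bijective (res VU).
Proof.
move=> UV; exists (res UV) => s.
  by rewrite (res_comp _ _ (@subset_refl _ U)) res_id.
by rewrite (res_comp _ _ (@subset_refl _ V)) res_id.
Qed.

Section IsoCriterion.
Variables (X Y : lr_space) (f : lr_mor X Y) (g : Y -> X).
Hypotheses (fK : cancel f g) (gK : cancel g f) (cg : continuous g).
Hypothesis f_bij : forall V : opens Y, bijective (mor_sharp f V).

Let pull (V : opens X) := opens_preim cg V.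
Let pullS (V : opens X) : opens_preim (mor_cts f) (pull V) `<=` V.
Proof. by move=> x; rewrite /= fK. Qed.
Let pullS' (V : opens X) : V `<=` opens_preim (mor_cts f) (pull V).
Proof. by move=> x; rewrite /= fK. Qed.

Let inv V := sval (cid (bij_rmorph (f_bij V))).
Let sharpK V : cancel (mor_sharp f V) (inv V).
Proof. by rewrite /inv; case: cid => ? []. Qed.
Let invK V : cancel (inv V) (mor_sharp f V).
Proof. by rewrite /inv; case: cid => ? []. Qed.

(** The preimage of [pull V] under [f] has the same points as [V] but is another term, hence the
    restriction before the inverse comorphism is applied. *)
Let inv_sharp (V : opens X) : {rmorphism O_ V -> O_ (pull V)} :=
  inv (pull V) \o res (@pullS V).

Let inv_sharpE V s : mor_sharp f (pull V) (inv_sharp V s) = res (@pullS V) s.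
Proof. exact: invK. Qed.

Program Definition inv_mor : lr_mor Y X := @LRMor Y X g cg inv_sharp _ _.
Next Obligation.
move=> V W WV h s; apply: (can_inj (@sharpK _)).
have h' : opens_preim (mor_cts f) (pull W) `<=` opens_preim (mor_cts f) (pull V).
  by move=> x; apply: h.
have h'' : opens_preim (mor_cts f) (pull W) `<=` V.
  by move=> x /pullS; apply: WV.
by rewrite (mor_nat h h') !inv_sharpE !(res_comp _ _ h'').
Qed.
Next Obligation.
move=> V s y Vy [W [WV [t [Wy e]]]].
have h : opens_preim (mor_cts f) W `<=` opens_preim (mor_cts f) (pull V).
  by move=> x; apply: WV.
have h' : opens_preim (mor_cts f) W `<=` V by move=> x /h; apply: pullS.
(* The comorphism of [f] carries the inverse [t] near [y] to an inverse near [g y]. *)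
exists (opens_preim (mor_cts f) W), h', (mor_sharp f W t).
split; first by rewrite /= gK.
have := congr1 (mor_sharp f W) e.
by rewrite rmorphM rmorph1 (mor_nat WV h) inv_sharpE (res_comp _ _ h').
Qed.

Lemma lr_isoP : lr_iso f.
Proof.
exists inv_mor; split; apply: lr_mor_ext => //= V h s.
  pose fV := opens_preim (mor_cts f) V; rewrite /lr_comp_sharp /lr_id_sharp /= -/fV.
  have VV : V `<=` pull fV by move=> y; rewrite /= gK.
  have fVV : fV `<=` opens_preim (mor_cts f) (pull fV) by move=> x; apply: VV.
  rewrite !(res_comp _ _ (VV : opens_preim (lr_id_cts (X:=Y)) V `<=` _)).
  apply: (can_inj (@sharpK _)).
  pose iV := opens_preim (lr_id_cts (X:=Y)) V.
  have ifV : opens_preim (mor_cts f) iV `<=` opens_preim (mor_cts f) V by [].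
  rewrite (mor_nat _ (fVV : opens_preim (mor_cts f) iV `<=` _)).
  rewrite -[inv _ _]/(inv_sharp fV _) inv_sharpE (mor_nat _ ifV).
  by rewrite (res_comp _ _ ifV).
rewrite /lr_comp_sharp /lr_id_sharp /=.
rewrite -[inv _ _]/(inv_sharp V _) inv_sharpE.
have h' : opens_preim (lr_id_cts (X:=X)) V `<=` opens_preim (mor_cts f) (pull V).
  by move=> x; apply: pullS'.
have iV : opens_preim (lr_id_cts (X:=X)) V `<=` V by [].
by rewrite (res_comp _ _ h') (res_comp _ _ iV); congr (res _ s); apply: Prop_irrelevance.
Qed.
End IsoCriterion.

(** * Restriction of a morphism to open subspaces *)

Section Restriction.
Variables (X Y : lr_space) (f : lr_mor X Y) (U : opens X) (V : opens Y).
Hypothesis UV : U `<=` opens_preim (mor_cts f) V.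

Definition restr_fun (x : open_sub U) : open_sub V :=
  exist _ (f (val x)) (mem_set (UV (set_valP x))).

Lemma restr_cts : continuous restr_fun.
Proof.
apply/continuousP => _ [B oB <-].
by exists (f @^-1` B) => //; move: (mor_cts f) => /continuousP; apply.
Qed.

Lemma restr_sub (W : opens (open_sub V)) :
  open_img (opens_preim restr_cts W) `<=` opens_preim (mor_cts f) (open_img W).
Proof. by move=> _ [x Wx <-]; exists (restr_fun x). Qed.

(** Sections over [W] are sections of [Y] over its image; the comorphism lands over the preimage in
    all of [X], which must then be cut down to [U]. *)
Definition restr_sharp (W : opens (open_sub V)) :
    {rmorphism O_ (open_img W) -> O_ (open_img (opens_preim restr_cts W))} :=
  res (@restr_sub W) \o mor_sharp f (open_img W).

Program Definition restr : lr_mor (open_sub U) (open_sub V) :=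
  @LRMor (open_sub U) (open_sub V) restr_fun restr_cts restr_sharp _ _.
Next Obligation.
move=> W T TW h s; rewrite /restr_sharp /=.
have h1 : opens_preim (mor_cts f) (open_img T) `<=`
          opens_preim (mor_cts f) (open_img W).
  by move=> x; apply: open_imgS.
have h2 : open_img (opens_preim restr_cts T) `<=`
          opens_preim (mor_cts f) (open_img W).
  by move=> x /restr_sub; apply: h1.
by rewrite (mor_nat _ h1) !(res_comp _ _ h2).
Qed.
Next Obligation.
move=> W s x Wx /open_sub_germ [T [TW [t [Tx e]]]].
apply/open_sub_germ/mor_local; first by exists (restr_fun x).
have h : T `<=` opens_preim (mor_cts f) (open_img W).
  by move=> y /TW; apply: restr_sub.
by exists T, h, t; split=> //; rewrite -e /restr_sharp /= (res_comp _ _ h).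
Qed.

Lemma restr_incl :
  lr_comp (open_incl V) restr = lr_comp f (open_incl U).
Proof.
apply: lr_mor_ext => // W h s; rewrite /= /lr_comp_sharp /restr_sharp /=.
pose T := open_img (opens_preim (open_incl_cts (U:=V)) W).
have TW : opens_preim (mor_cts f) T `<=` opens_preim (mor_cts f) W.
  by move=> x; apply: open_incl_sub.
rewrite (mor_nat _ TW).
have h1 : open_img (opens_preim (mor_cts (lr_comp f (open_incl U))) W) `<=`
          opens_preim (mor_cts f) T.
  by move=> _ [x Wx <-]; exists (restr_fun x).
have h2 : open_img (opens_preim (mor_cts (lr_comp f (open_incl U))) W) `<=`
          opens_preim (mor_cts f) W.
  by move=> x /h1 /TW.
have h3 : open_img (opens_preim (mor_cts (lr_comp (open_incl V) restr)) W) `<=`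
          opens_preim (mor_cts f) W.
  by move=> _ [x Wx <-].
have h4 : open_img (opens_preim (mor_cts (lr_comp (open_incl V) restr)) W) `<=`
          opens_preim (mor_cts f) T.
  by move=> _ [x Wx <-]; exists (restr_fun x).
by rewrite !(res_comp _ _ h4) !(res_comp _ _ h3) !(res_comp _ _ h2).
Qed.
End Restriction.

(** * The isomorphism between complements of zero sets *)

Section OpenIsomorphism.
Variables (A B : comPzRingType) (f : {rmorphism A -> B}).
Variables (H : ideal A) (J : ideal B).
Hypothesis HJ : ideal_bij f H J.

Section Sections.
Variable V : opens (Spec A).
Hypothesis VH : V `<=` ~` zeros H.
Local Notation fV := (opens_preim (spec_preim_cts (f := f)) V).

Let fV_zeros (y : fV) : ~ zeros J (val y).
Proof. by rewrite -(zeros_preim HJ); apply/VH/(set_valP y). Qed.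

Let preim_point_surj (x : V) : exists y : fV, x = preim_point y.
Proof.
have PH := VH (set_valP x).
have fVQ : spec_preim f (ext_spec HJ PH) \in oset V.
  by rewrite ext_specK; apply/mem_set/set_valP.
exists (exist _ (ext_spec HJ PH) (mem_set (set_mem fVQ))).
by apply: val_inj; rewrite /= ext_specK.
Qed.

Let preim_point_inj : injective (preim_point (f := f) (V := V)).
Proof.
move=> y z /(congr1 val) /= e.
exact/val_inj/(spec_preim_inj HJ (@fV_zeros y)).
Qed.

Let loc_at_bij (y : fV) : bijective (loc_at f (val y)).
Proof. exact: (@loc_map_bij _ _ _ _ _ HJ). Qed.

(** Outside V([H]), contraction is bijective on points and on local rings, so a section over the
    preimage determines one candidate germ at each point. What remains is that these germs are
    locally fractions. *)
Lemma spec_sharp_bij : bijective (spec_sharp f (V := V)).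
Proof.
apply: inj_surj_bij => [s s' ss'|t].
  apply: sectionP => x; have [y ->] := preim_point_surj x.
  apply: (bij_inj (loc_at_bij y)).
  exact: (congr1 (fun u : spec_sections fV => germ_of u y) ss').
(* The type of a germ depends on its point, so the germ at [x] is transported along
   [x = preim_point y] before it is compared with [t] at [y]. *)
have lift (x : V) : {v : loc (val x) | forall y (e : x = preim_point y),
    loc_at f (val y) (eq_rect x (fun x => loc (val x)) v _ e) = germ_of t y}.
  apply: cid; have [y0 ->] := preim_point_surj x.
  have [r _ rK] := loc_at_bij y0; exists (r (germ_of t y0)) => y e.
  have ye := preim_point_inj e; case: _ / ye in e *.
  by rewrite (Prop_irrelevance e erefl) /= rK.
pose s : germs V := fun x => sval (lift x).
have sE y : loc_at f (val y) (s (preim_point y)) = germ_of t y.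
  exact: (svalP (lift (preim_point y)) y erefl).
have s_reg : regular s.
  apply/asboolP => x; have [y xy] := preim_point_surj x.
  have /not_zerosP [c Hc Pc] := VH (set_valP x).
  have /asboolP /(_ y) [W [b [g [Wy tW]]]] := germ_ofP t.
  have [K WE] := opensP W; rewrite WE in Wy.
  have [_ _ HJs] := HJ; have HJi a : H a -> J (f a) by case: HJ => h _ _; apply: h.
  (* Near [y] the section [t] is [b / g], and [b * f c] and [g * f c] lie in [J], hence come from
     elements [d] and [e]; the lifted section is [d / e] near [x]. *)
  have [d Hd fd] := HJs _ (idealM b (HJi c Hc)).
  have [e He fe] := HJs _ (idealM g (HJi c Hc)).
  (* Points of [Wc] in [V] come from points of [W], and [c] does not vanish there, so [e] is a valid
     denominator. *)
  pose Wc := opensI (zeros_compl (contract_in f H K)) (basic_open c).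
  exists Wc, d, e; split=> [|z [/=]].
    split=> //=; rewrite xy; move: Wy; apply: contra_not.
    by move/(zeros_contract_in HJ K (@fV_zeros y)).
  have [y' ->] := preim_point_surj z => Ky' cy'.
  have Wy' : oset W (val y').
    rewrite WE /=; move: Ky'; apply: contra_not.
    by move=> ?; apply/(zeros_contract_in HJ K (@fV_zeros y')).
  have [hg tE] := tW y' Wy'.
  have he : ~ spec_preim f (val y') e by rewrite /= fe; apply: prime_mul.
  exists he; apply: (bij_inj (loc_at_bij y')).
  rewrite sE tE [RHS]loc_mapE; apply: frac_eq => /=.
  by rewrite fd fe; ring.
by exists (SpecSection s_reg); apply: sectionP.
Qed.
End Sections.

Let D_sub : zeros_compl J `<=` opens_preim (mor_cts (Spec_map f)) (zeros_compl H).
Proof. by move=> Q; rewrite /= (zeros_preim HJ). Qed.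

Definition open_restr : lr_mor (open_subscheme J) (open_subscheme H) :=
  restr D_sub.

Let ext_point_in (x : open_subscheme H) :
  oset (zeros_compl J) (ext_spec HJ (set_valP x) : Spec B).
Proof.
by move/(zeros_preim HJ); rewrite ext_specK; apply: (set_valP x).
Qed.

Let ext_point (x : open_subscheme H) : open_subscheme J :=
  exist _ (ext_spec HJ (set_valP x) : Spec B) (mem_set (@ext_point_in x)).

Let ext_point_cts : continuous ext_point.
Proof.
apply/continuousP => _ [_ [K ->] <-].
exists (~` zeros (contract_in f H K)); first by exists (contract_in f H K).
apply/seteqP; split=> x /=; apply: contra_not;
  have := zeros_contract_in HJ K (@ext_point_in x);
  by rewrite ext_specK => -[].
Qed.

Lemma open_restr_iso : lr_iso open_restr.
Proof.
apply: (@lr_isoP _ _ open_restr ext_point).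
- move=> y; apply: val_inj; apply: (spec_preim_inj HJ).
    exact: ext_point_in.
  exact: ext_specK.
- by move=> x; apply: val_inj; apply: ext_specK.
- exact: ext_point_cts.
move=> W; have WH : open_img W `<=` ~` zeros H by move=> _ [x _ <-]; apply: (set_valP x).
(* The comorphism of the restriction is that of [Spec_map f] followed by a restriction between open
   sets with the same points, since every prime over [open_img W] lies outside V([J]). *)
apply: (bij_comp _ (spec_sharp_bij WH)).
apply: (res_eq_bij (@restr_sub _ _ _ _ _ D_sub W)) => Q [x Wx e].
have QJ : oset (zeros_compl J) (Q : Spec B).
  by move/(zeros_preim HJ); rewrite -[spec_preim f Q]e; apply: (set_valP x).
exists (exist _ Q (mem_set QJ)) => //=.
suff <- : x = restr_fun D_sub (exist _ Q (mem_set QJ)) by [].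
exact: val_inj.
Qed.

Lemma open_restricts_to_iso :
  restricts_to_iso (Spec_map f) (open_immersion J) (open_immersion H).
Proof. by exists open_restr; split; [apply: restr_incl|apply: open_restr_iso]. Qed.
End OpenIsomorphism.

(** * Functoriality of the spectrum *)

Lemma loc_map_germ (A B : comPzRingType) (f f' : {rmorphism A -> B}) (V : opens (spec A))
    (s : germs V) (x x' : V) (Q : spec B)
    (h : forall a, ~ val x a -> ~ Q (f a)) (h' : forall a, ~ val x' a -> ~ Q (f' a)) :
  f =1 f' -> x = x' -> loc_map h (s x) = loc_map h' (s x').
Proof.
(* Substituting both equalities makes the types of the germs agree; only two proofs of one
   proposition still differ. *)
move=> /rmorph_ext ff' xx'; case: _ / xx' in h' *; case: _ / ff' in h' *.
by rewrite (Prop_irrelevance h h').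
Qed.

Lemma loc_map_idE (A : comPzRingType) (P : spec A) (h : forall a, ~ P a -> ~ P a) (x : loc P) :
  loc_map (f := idfun) h x = x.
Proof. by elim/loc_ind: x => a s; rewrite [LHS]loc_mapE; apply: frac_eq. Qed.

Lemma loc_map_compE (A B C : comPzRingType) (f : {rmorphism A -> B})
    (g : {rmorphism B -> C}) (P : spec A) (Q : spec B) (S : spec C)
    (hf : forall a, ~ P a -> ~ Q (f a)) (hg : forall b, ~ Q b -> ~ S (g b))
    (h : forall a, ~ P a -> ~ S (g (f a))) (x : loc P) :
  loc_map hg (loc_map hf x) = loc_map (f := g \o f) h x.
Proof. by elim/loc_ind: x => a s; rewrite !loc_mapE; apply: frac_eq. Qed.

Lemma Spec_map_comp (A B C : comPzRingType) (f : {rmorphism A -> B})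
    (g : {rmorphism B -> C}) :
  lr_comp (Spec_map f) (Spec_map g) = Spec_map (g \o f).
Proof.
apply: lr_mor_ext => [Q|V h s]; first exact: spec_ext.
apply: sectionP => y.
rewrite /= /sharp_fun /spec_res_fun /= /spec_res_fun /= /sharp_fun /= /loc_at.
set x : V := preim_point (preim_point _).
have hgf a : ~ val x a -> ~ val y (g (f a)) by [].
rewrite (loc_map_compE _ _ hgf).
apply: (loc_map_germ (germ_of s) (x := x) (x' := preim_point y)) => //.
exact/val_inj/spec_ext.
Qed.

Lemma Spec_map_id (A : comPzRingType) : Spec_map (idfun : {rmorphism A -> A}) = lr_id (Spec A).
Proof.
apply: lr_mor_ext => [Q|V h s]; first exact: spec_ext.
apply: sectionP => y.
rewrite /= /sharp_fun /spec_res_fun /= /spec_res_fun /= /sharp_fun /= /loc_at.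
set x : V := preim_point _; set x' : V := sub_incl _ y.
rewrite -[RHS](loc_map_idE (fun _ h => h)).
apply: (loc_map_germ (germ_of s) (x := x) (x' := x')) => //.
exact/val_inj/spec_ext.
Qed.

Lemma Spec_map_iso (A B : comPzRingType) (f : {rmorphism A -> B}) :
  bijective f -> lr_iso (Spec_map f).
Proof.
move=> /bij_rmorph[g [fK gK]]; exists (Spec_map g).
rewrite !Spec_map_comp -!Spec_map_id; split; congr Spec_map;
  by apply: rmorph_ext => x /=; rewrite ?fK ?gK.
Qed.

(** * Quotient maps and closed subschemes *)

Section QuotientMap.
Variables (A B : comPzRingType) (f : {rmorphism A -> B}) (H : ideal A) (K : ideal B).
Hypothesis HK : forall a, H a -> K (f a).

Definition quo_map (x : quo H) : quo K := quo_class K (f (repr x)).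

Lemma quo_mapE a : quo_map (quo_class H a) = quo_class K (f a).
Proof. by apply/quo_classP; rewrite -rmorphB; apply/HK/quo_repr. Qed.

Lemma quo_map_zmod : zmod_morphism quo_map.
Proof.
elim/quo_ind => a; elim/quo_ind => b.
by rewrite -rmorphB !quo_mapE -!rmorphB.
Qed.
Lemma quo_map_monoid : monoid_morphism quo_map.
Proof.
split; first by rewrite -(rmorph1 (quo_class H)) quo_mapE !rmorph1.
elim/quo_ind => a; elim/quo_ind => b.
by rewrite -rmorphM !quo_mapE -!rmorphM.
Qed.
HB.instance Definition _ := GRing.isZmodMorphism.Build (quo H) (quo K) quo_map quo_map_zmod.
HB.instance Definition _ := GRing.isMonoidMorphism.Build (quo H) (quo K) quo_map quo_map_monoid.

Lemma quo_map_bij : (forall a, K (f a) -> H a) ->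
  (forall b, exists a, K (f a - b)) -> bijective quo_map.
Proof.
move=> KH fS; apply: inj_surj_bij.
  elim/quo_ind => a; elim/quo_ind => b; rewrite !quo_mapE => /quo_classP.
  by rewrite -rmorphB => /KH ?; apply/quo_classP.
elim/quo_ind => b; have [a Ka] := fS b; exists (quo_class H a).
by rewrite quo_mapE; apply/quo_classP.
Qed.

Lemma closed_restricts_to_iso : bijective quo_map ->
  restricts_to_iso (Spec_map f) (closed_immersion K) (closed_immersion H).
Proof.
move=> bf; exists (Spec_map quo_map); split; last exact: Spec_map_iso.
rewrite !Spec_map_comp; congr Spec_map; apply: rmorph_ext => a; exact: quo_mapE.
Qed.
End QuotientMap.

(** * Sections of localization maps and pullbacks of rings *)

Lemma lr_iso_isomorphic (X Y : lr_space) (f : lr_mor X Y) : lr_iso f -> isomorphic Y X.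
Proof. by move=> [g [fg gf]]; exists g, f. Qed.

(** A section of a bijection is its inverse, and localizing preserves sections. The map induced by
    the diagonal is thereby reduced to a projection. *)
Lemma loc_map_section_bij (A B : comPzRingType) (f : {rmorphism A -> B})
    (g : {rmorphism B -> A}) (P : spec A) (Q : spec B)
    (hf : forall a, ~ P a -> ~ Q (f a)) (hg : forall b, ~ Q b -> ~ P (g b)) :
  cancel f g -> bijective (loc_map hg) -> bijective (loc_map hf).
Proof.
move=> fK; apply: cancel_bij_section.
by elim/loc_ind => a s; rewrite !loc_mapE; apply: frac_eq; rewrite /= !fK.
Qed.

Lemma ideal_bij_comp (A B C : comPzRingType) (f : {rmorphism A -> B})
    (g : {rmorphism B -> C}) (H : ideal A) (J : ideal B) (K : ideal C) :
  ideal_bij f H J -> ideal_bij g J K -> ideal_bij (g \o f) H K.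
Proof.
move=> [f_in f_inj f_surj] [g_in g_inj g_surj]; split=> [a /f_in/g_in //|a Ha /=|c Kc].
  by move=> /(g_inj _ (f_in a Ha)); apply: f_inj.
by have [b /f_surj[a Ha <-] <-] := g_surj c Kc; exists a.
Qed.

(** Joint injectivity of [f] and [g] gives uniqueness, and also forces the function that chooses
    preimages to be a ring homomorphism. *)
Lemma is_pullbackP (A B C D : comPzRingType) (f : {rmorphism A -> B})
    (g : {rmorphism A -> C}) (u : {rmorphism B -> D}) (v : {rmorphism C -> D}) :
  u \o f =1 v \o g ->
  (forall a a', f a = f a' -> g a = g a' -> a = a') ->
  (forall b c, u b = v c -> exists a, f a = b /\ g a = c) ->
  is_pullback f g u v.
Proof.
move=> ufvg fgI fgS; split=> // T b c ubvc.
pose h t := sval (cid (fgS _ _ (ubvc t))).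
have hP t : f (h t) = b t /\ g (h t) = c t by rewrite /h; case: cid.
have fh t : f (h t) = b t by case: (hP t).
have gh t : g (h t) = c t by case: (hP t).
have h_zmod : zmod_morphism h.
  by move=> t t'; apply: fgI; rewrite rmorphB ?fh ?gh rmorphB.
have h_monoid : monoid_morphism h.
  by split=> [|t t']; apply: fgI; rewrite ?rmorph1 ?rmorphM ?fh ?gh ?rmorph1 ?rmorphM.
pose hZ := GRing.isZmodMorphism.Build T A h h_zmod.
pose hM := GRing.isMonoidMorphism.Build T A h h_monoid.
pose hR : {rmorphism T -> A} := HB.pack h hZ hM.
exists hR; split=> [//|h' [fh' gh']]; apply: rmorph_ext => t.
by apply: fgI; rewrite /= ?fh ?gh ?[RHS]fh' ?[RHS]gh'.
Qed.

(** * The duplication inside the product *)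

Lemma dup_predP (R : comPzRingType) (I : ideal R) (z : R * R) : dup_pred I z <-> I (z.2 - z.1).
Proof.
split=> [/asboolP[r [i [Ii ->]]]|Iz]; first by rewrite /= addrAC subrr add0r.
by apply/asboolP; exists z.1, (z.2 - z.1); rewrite [_ + (_ - _)]addrC subrK; case: z Iz.
Qed.

Section Lift.
Variables (R A : comPzRingType) (I : ideal R) (f : {rmorphism A -> R * R}).
Hypothesis f_dup : forall a, dup_pred I (f a).
Definition dup_lift (a : A) : dup I := Dup (f_dup a).
Lemma dup_lift_zmod : zmod_morphism dup_lift.
Proof. by move=> a b; apply: val_inj; apply: rmorphB. Qed.
Lemma dup_lift_monoid : monoid_morphism dup_lift.
Proof. by split=> [|a b]; apply: val_inj; [apply: rmorph1|apply: rmorphM]. Qed.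
HB.instance Definition _ := GRing.isZmodMorphism.Build A (dup I) dup_lift dup_lift_zmod.
HB.instance Definition _ := GRing.isMonoidMorphism.Build A (dup I) dup_lift dup_lift_monoid.
End Lift.

Section Duplication.
Variables (R : comPzRingType) (I : ideal R).

Lemma ideal_bij_snd : ideal_bij (snd : {rmorphism R * R -> R}) (zero_times I) I.
Proof.
split=> [z []//|[x y] /= [-> _] -> //|y Iy]; by exists (0, y).
Qed.

Lemma ideal_bij_fst : ideal_bij (fst : {rmorphism R * R -> R}) (times_zero I) I.
Proof.
split=> [z []//|[x y] /= [_ ->] -> //|y Iy]; by exists (y, 0).
Qed.

Lemma ideal_bij_incl (O : ideal (R * R)%type) : (forall z, O z -> dup_pred I z) ->
  ideal_bij (dup_incl I) (ideal_preim (dup_incl I) O) O.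
Proof.
move=> Odup; split=> [//|z _ z0|z Oz]; first exact: val_inj.
by exists (Dup (Odup z Oz)).
Qed.

Lemma zero_times_dup (z : R * R) : zero_times I z -> dup_pred I z.
Proof. by move=> [z0 Iz]; apply/dup_predP; rewrite z0 subr0. Qed.

Lemma times_zero_dup (z : R * R) : times_zero I z -> dup_pred I z.
Proof. by move=> [Iz z0]; apply/dup_predP; rewrite z0 sub0r; apply: idealN. Qed.

Lemma dup_prime1E (P : spec R) :
  dup_prime1 I P = ideal_set (prime_times P) `&` range (dup_incl I).
Proof.
apply/seteqP; split=> [_ [p [x [Pp Ix ->]]]|z [Pz [[[p q] pq] _ e]]].
  split=> //; have pq : dup_pred I (p, p + x) by apply/asboolP; exists p, x.
  by exists (Dup pq).
rewrite -{}e /= in Pz *; move/dup_predP: (pq) => Ix; exists p, (q - p).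
by split=> //; rewrite [_ + (_ - _)]addrC subrK.
Qed.

Lemma dup_prime2E (P : spec R) :
  dup_prime2 I P = ideal_set (times_prime P) `&` range (dup_incl I).
Proof.
apply/seteqP; split=> [_ [p [x [Pp Ix ->]]]|z [Pz [[[p q] pq] _ e]]].
  split=> //; have pq : dup_pred I (p + x, p).
    by apply/dup_predP; rewrite opprD addrA subrr sub0r; apply: idealN.
  by exists (Dup pq).
rewrite -{}e /= in Pz *; move/dup_predP: (pq) => Ix; exists q, (p - q).
by split=> //; [rewrite -opprB; apply: idealN|rewrite [_ + (_ - _)]addrC subrK].
Qed.

(** * The extension of [I] to the localization at [P] *)

Section LocIdeal.
Variable P : spec R.

(** Being an ideal that contains the generators, it bounds [loc_ideal] from above. *)
Program Definition frac_ideal : ideal (loc P) :=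
  @Ideal (loc P) [set x | exists a s, I a /\ x = Defs.frac a s] _ _ _.
Next Obligation. by exists 0, (denom1 P); split=> //; apply: ideal0. Qed.
Next Obligation.
move=> _ _ [a [s [Ia ->]]] [b [t [Ib ->]]].
exists (a * sval t + b * sval s), (denomM s t); rewrite fracD; split=> //.
by rewrite ![_ * sval _]mulrC; apply: idealD; apply: idealM.
Qed.
Next Obligation.
elim/loc_ind => b t _ [a [s [Ia ->]]]; exists (b * a), (denomM t s).
by rewrite fracM; split=> //; apply: idealM.
Qed.

(** A fraction in the extended ideal may have its numerator outside [I], since equality of fractions
    is only up to a multiplier; hence [w]. *)
Lemma loc_idealP a s :
  loc_ideal I P (Defs.frac a s) <-> exists2 w, ~ P w & I (w * a).
Proof.
split=> [/(_ frac_ideal) h|[w Pw Iwa] K IK].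
  have [_ [i Ii <-]|b [t [Ib]]] := h; first by exists i, (denom1 P).
  move=> /fracP[u Pu e]; exists (u * sval t); first exact: (prime_mul Pu (svalP t)).
  by rewrite -mulrA [sval t * a]mulrC e; apply: idealM; rewrite mulrC; apply: idealM.
have -> : Defs.frac a s =
    Defs.frac 1 (denomM s (exist _ w Pw)) * loc_in P (w * a).
  by rewrite /loc_in fracM; apply: frac_eq => /=; ring.
by apply/idealM/IK; exists (w * a).
Qed.
End LocIdeal.

(** * The localization of the duplication over a prime containing [I] *)

Section LocDup.
Variable P : spec R.
Hypothesis IP : forall a, I a -> P a.
Let Q : spec (dup I) := spec_preim (dup_fst I) P.

(** The coordinates differ by an element of [I], hence of [P]; so both projections contract [P] to
    the same prime [Q]. *)
Lemma dup_fstE (z : dup I) : P (dup_fst I z) <-> P (dup_snd I z).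
Proof.
have /dup_predP/IP Pz := dup_valP z.
split=> [Pz1|Pz2].
  by rewrite -[dup_snd I z](subrK (dup_fst I z)); apply: idealD.
rewrite -[dup_fst I z](subKr (dup_snd I z)); exact: idealB.
Qed.

Lemma spec_preim_diag_uniq : unique (fun Q' => spec_preim (dup_diag I) Q' = P) Q.
Proof.
split=> [|Q' Q'P]; first exact: spec_ext.
have Q'E a : Q' (dup_diag I a) <-> P a by rewrite -Q'P.
(* The difference [d] is [(0, i)] with [i] in [I], so [d * d] is [d] times [(i, i)], which lies in
   [Q'] because [I] lies in [P]. Hence [d] is in [Q'], and [Q'] is determined by its contraction. *)
have diagP z : Q' (z - dup_diag I (dup_fst I z)).
  have /dup_predP/IP/Q'E Q'z := dup_valP z; set d := z - _.
  suff : Q' (d * d) by move=> /(prime_idealP Q').2 [].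
  have -> : d * d = d * dup_diag I ((dup_val z).2 - (dup_val z).1).
    by apply: val_inj; congr pair; rewrite /= subrr !mul0r.
  exact: idealM.
apply: spec_ext => z; rewrite /= -Q'E; split=> h.
  by rewrite -[z](subrK (dup_diag I (dup_fst I z))); apply: idealD.
by rewrite -[dup_diag I _](subKr z); apply: idealB.
Qed.

Variables (h1 : forall z, ~ Q z -> ~ P (dup_fst I z))
          (h2 : forall z, ~ Q z -> ~ P (dup_snd I z)).

Lemma loc_dup_inj x y :
  loc_map h1 x = loc_map h1 y -> loc_map h2 x = loc_map h2 y -> x = y.
Proof.
elim/loc_ind: x => a s; elim/loc_ind: y => b t; rewrite !loc_mapE.
move=> /fracP[u Pu /= e1] /fracP[w Pw /= e2]; apply/fracP.
(* Each coordinate has its own multiplier; their product on the diagonal serves both. *)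
exists (dup_diag I (u * w)); first exact: (prime_mul Pu Pw).
apply: val_inj; congr pair => /=; first by rewrite ![u * w]mulrC -!mulrA e1.
by rewrite -!mulrA e2.
Qed.

Lemma loc_dup_diff x : loc_ideal I P (loc_map h2 x - loc_map h1 x).
Proof.
elim/loc_ind: x => a s; rewrite !loc_mapE fracN fracD; apply/loc_idealP.
exists 1; first exact: (prime_idealP P).1.
rewrite mul1r /=; move: (dup_valP a) (dup_valP (sval s)) => /dup_predP + /dup_predP.
case: (dup_val a) => a1 a2; case: (dup_val (sval s)) => s1 s2 /= Ia Is.
have -> : a2 * s1 + - a1 * s2 = s1 * (a2 - a1) - a1 * (s2 - s1) by ring.
by apply: idealB; apply: idealM.
Qed.

Lemma loc_dup_surj x y : loc_ideal I P (y - x) ->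
  exists z, loc_map h1 z = x /\ loc_map h2 z = y.
Proof.
elim/loc_ind: x => a s; elim/loc_ind: y => b t.
rewrite fracN fracD => /loc_idealP[w Pw Iw].
(* These are the numerators of [a / s] and [b / t] over the common denominator [d] below; the factor
   [w] puts their difference in [I]. *)
have ab : dup_pred I (w * (a * sval t), w * (b * sval s)).
  by apply/dup_predP; rewrite /= -mulrBr -mulNr.
pose d := w * (sval s * sval t).
have Qd : ~ Q (dup_diag I d) by apply: (prime_mul Pw (prime_mul (svalP s) (svalP t))).
exists (Defs.frac (Dup ab) (exist _ (dup_diag I d) Qd)).
by split; rewrite loc_mapE; apply: frac_eq; rewrite /= /d; ring.
Qed.

Lemma loc_dup_pullback :
  is_pullback (loc_map h1) (rpair (loc_map h1) (loc_map h2))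
    (pullback_u I P) (pullback_v I P).
Proof.
apply: is_pullbackP => [x|x y _ [e1 e2]|x [x' y] [<- xy]].
- congr pair; apply/quo_classP; rewrite -opprB.
  exact/idealN/loc_dup_diff.
- exact: loc_dup_inj.
have [|z [<- <-]] := @loc_dup_surj x y; last by exists z.
by rewrite -opprB; apply/idealN/quo_classP.
Qed.

Lemma loc_dup_iso : ring_isomorphic (loc Q) (dup (loc_ideal I P)).
Proof.
have h_dup x : dup_pred (loc_ideal I P) (rpair (loc_map h1) (loc_map h2) x).
  exact/dup_predP/loc_dup_diff.
exists (dup_lift h_dup); apply: inj_surj_bij => [x y /(congr1 val) [e1 e2]|].
  exact: loc_dup_inj.
move=> [[x y] xy]; have /dup_predP /= /loc_dup_surj [z [zx zy]] := xy.
by exists z; apply: val_inj; congr pair.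
Qed.
End LocDup.
End Duplication.

Theorem theorem3p8 (R : comPzRingType) (I : ideal R)
    (I_neq0 : ideal_set I <> [set 0]) (I_neqR : ideal_set I <> setT) :
  let alpha : lr_mor (Spec (R * R)%type) (Spec (dup I)) := Spec_map (dup_incl I) in
  let gamma : lr_mor (Spec (dup I)) (Spec R) := Spec_map (dup_diag I) in
  let O1Z : ideal (R * R)%type := zero_times I in
  let O2Z : ideal (R * R)%type := times_zero I in
  let O1Y : ideal (dup I) := ideal_preim (dup_incl I) O1Z in
  let O2Y : ideal (dup I) := ideal_preim (dup_incl I) O2Z in
  ((restricts_to_iso alpha (open_immersion O1Z) (open_immersion O1Y) /\
    isomorphic (open_subscheme O1Z) (open_subscheme I)) /\
   (restricts_to_iso alpha (open_immersion O2Z) (open_immersion O2Y) /\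
    isomorphic (open_subscheme O2Z) (open_subscheme I)) /\
   forall P : spec R, ~ (ideal_set I `<=` ideal_set P) ->
     let Q1 : spec (dup I) := spec_preim (dup_incl I) (prime_times P) in
     let Q2 : spec (dup I) := spec_preim (dup_incl I) (times_prime P) in
     (dup_prime1 I P = ideal_set (prime_times P) `&` range (dup_incl I) /\
      (exists h : forall r : R, ~ P r -> ~ Q1 (dup_diag I r),
         bijective (loc_map h)) /\
      bijective (loc_at (dup_incl I) (prime_times P))) /\
     (dup_prime2 I P = ideal_set (times_prime P) `&` range (dup_incl I) /\
      (exists h : forall r : R, ~ P r -> ~ Q2 (dup_diag I r),
         bijective (loc_map h)) /\
      bijective (loc_at (dup_incl I) (times_prime P)))) /\
  restricts_to_iso gamma (closed_immersion (ideal_sum O1Y O2Y)) (closed_immersion I) /\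
  (forall P : spec R, ideal_set I `<=` ideal_set P ->
     exists Q : spec (dup I),
       unique (fun Q' : spec (dup I) => spec_preim (dup_diag I) Q' = P) Q /\
       (exists (h1 : forall z : dup I, ~ Q z -> ~ P (dup_fst I z))
               (h2 : forall z : dup I, ~ Q z -> ~ P (dup_snd I z)),
          is_pullback (loc_map h1) (rpair (loc_map h1) (loc_map h2))
            (pullback_u I P) (pullback_v I P)) /\
       ring_isomorphic (loc Q) (dup (loc_ideal I P))).
Proof.
move=> alpha gamma O1Z O2Z O1Y O2Y.
have b1 : ideal_bij (dup_incl I) O1Y O1Z by apply/ideal_bij_incl/zero_times_dup.
have b2 : ideal_bij (dup_incl I) O2Y O2Z by apply/ideal_bij_incl/times_zero_dup.
have sub1 z : O1Y z -> ideal_sum O1Y O2Y z.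
  by move=> Oz; exists z, 0; rewrite addr0; split=> //; apply: ideal0.
have sub2 z : O2Y z -> ideal_sum O1Y O2Y z.
  by move=> Oz; exists 0, z; rewrite add0r; split=> //; apply: ideal0.
split; last split.
- split; last split.
  + split; first exact: open_restricts_to_iso b1.
    (* Every prime P x R contains (0) x I, so the open set lies in the copy of X given by the second
       projection. *)
    exact: lr_iso_isomorphic (open_restr_iso (ideal_bij_snd I)).
  + split; first exact: open_restricts_to_iso b2.
    exact: lr_iso_isomorphic (open_restr_iso (ideal_bij_fst I)).
  move=> P IP Q1 Q2; split; (split; [by [apply: dup_prime1E|apply: dup_prime2E]|split]).
  (* The indices cross: P x R contains (0) x I but not I x (0), so [b2] and the first projection
     apply. The diagonal is a section of that projection. *)
  + exists (fun r Pr => Pr).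
    have h (z : dup I) : ~ Q1 z -> ~ P (dup_fst I z) by [].
    have /(loc_map_section_bij (f := dup_diag I)) : bijective (loc_map h).
      exact: (loc_map_bij (ideal_bij_comp b2 (ideal_bij_fst I))).
    exact.
  + apply: (loc_map_bij b2) => //.
    by move/(zeros_preim (ideal_bij_fst I)).
  + exists (fun r Pr => Pr).
    have h (z : dup I) : ~ Q2 z -> ~ P (dup_snd I z) by [].
    have /(loc_map_section_bij (f := dup_diag I)) : bijective (loc_map h).
      exact: (loc_map_bij (ideal_bij_comp b1 (ideal_bij_snd I))).
    exact.
  + apply: (loc_map_bij b1) => //.
    by move/(zeros_preim (ideal_bij_snd I)).
(* The decomposition is [(r, r) = (0, r) + (r, 0)]. *)
- have diagP r : I r -> ideal_sum O1Y O2Y (dup_diag I r).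
    move=> Ir; have dup_0r : dup_pred I (0, r) by apply/dup_predP; rewrite subr0.
    have dup_r0 : dup_pred I (r, 0) by apply/dup_predP; rewrite sub0r; apply: idealN.
    exists (Dup dup_0r), (Dup dup_r0); split=> //.
    by apply: val_inj; congr pair; rewrite /= ?add0r ?addr0.
  apply: (@closed_restricts_to_iso _ _ _ _ _ diagP); apply: (quo_map_bij diagP) => [r|z].
    move=> [a [b [[a0 _] [Ib _] /(congr1 (dup_fst I))]]].
    by rewrite /= a0 add0r => ->.
  (* Modulo [O1Y], an element equals the diagonal of its first coordinate. *)
  exists (dup_fst I z); rewrite -opprB; apply/idealN/sub1.
  by split; [rewrite /= subrr|exact/dup_predP/(dup_valP z)].
move=> P IP; exists (spec_preim (dup_fst I) P); split; first exact: spec_preim_diag_uniq.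
have h2 z : ~ spec_preim (dup_fst I) P z -> ~ P (dup_snd I z).
  by apply: contra_not => /(dup_fstE IP).
by split; [exists (fun z Pz => Pz), h2; apply: loc_dup_pullback|apply: loc_dup_iso h2].
Qed.
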